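(* Let $S$ be a finite or countable set, $G$ a finite or countable set of maps $S\to S$, $c:S\times G\to[0,\infty)$, and $\pi$ a probability measure on $S$ such that the reversibility condition (Rev) of the context holds and the Markov chain with generator $\mathcal{L}f(\eta)=\sum_{\gamma\in G}c(\eta,\gamma)\nabla_\gamma f(\eta)$ is irreducible. Let $R:S\times G\times G\to[0,+\infty)$ satisfy properties (P1), (P2), (P3) of the context and set $$\Gamma(\eta,\gamma,\delta):=c(\eta,\gamma)c(\eta,\delta)-R(\eta,\gamma,\delta).$$ Suppose there exists a constant $\kappa>0$ such that for every $f>0$ $$\pi\Big[\sum_{\gamma,\delta}\Gamma(\eta,\gamma,\delta)\Big(\nabla_\gamma f(\eta)\nabla_\delta\log f(\eta)+\frac{\nabla_\gamma f(\eta)\nabla_\delta f(\eta)}{f(\eta)}\Big)\Big]\ \ge\ \frac{\kappa}{2}\,\pi\Big[\sum_{\gamma\in G}c(\eta,\gamma)\nabla_\gamma f(\eta)\nabla_\gamma\log f(\eta)\Big].$$ Then for every $f>0$ $$\kappa\,\mathcal{E}(f,\log f)\le\pi\big[\mathcal{L}f\,\mathcal{L}\log f\big]+\pi\Big[\frac{(\mathcal{L}f)^2}{f}\Big].$$ In particular, the modified logarithmic Sobolev inequality holds with constant $\kappa$: for every $f>0$, $\ \kappa\,\mathrm{Ent}_\pi(f)\le\mathcal{E}(f,\log f)$.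
   Context: Functions $f$ are real-valued on $S$; $\nabla_\gamma f(\eta)=f(\gamma(\eta))-f(\eta)$; $\pi[\cdot]$ is expectation (in $\eta$) under $\pi$; $\mathcal{E}(f,g)=-\pi[f\mathcal{L}g]$, which under (Rev) equals $\frac12\pi[\sum_{\gamma\in G}c(\eta,\gamma)\nabla_\gamma f(\eta)\nabla_\gamma g(\eta)]$; $\mathrm{Ent}_\pi(f)=\pi[f\log f]-\pi[f]\log\pi[f]$ if $f\log f\in L^1(\pi)$, and $+\infty$ otherwise. (Rev): for every $\gamma\in G$ there exists $\gamma^{-1}\in G$ such that $\gamma^{-1}(\gamma(\eta))=\eta$ for every $\eta\in S$ with $c(\eta,\gamma)>0$; moreover, for every bounded $f:S\to\mathbb{R}$, $\pi[c(\eta,\gamma)f(\eta)]=\pi[c(\eta,\gamma^{-1})f(\gamma^{-1}(\eta))]$. (P1): $R(\eta,\gamma,\delta)=R(\eta,\delta,\gamma)$ for all $\eta,\gamma,\delta$ with $R(\eta,\gamma,\delta)>0$. (P2): $\pi[\sum_{\gamma,\delta}R(\eta,\gamma,\delta)\psi(\eta,\gamma,\delta)]=\pi[\sum_{\gamma,\delta}R(\eta,\gamma,\delta)\psi(\gamma(\eta),\gamma^{-1},\delta)]$ for every bounded $\psi:S\times G\times G\to\mathbb{R}$. (P3): $\gamma(\delta(\eta))=\delta(\gamma(\eta))$ for all $\eta,\gamma,\delta$ with $R(\eta,\gamma,\delta)>0$.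
   Formalization: Two assumptions are added, without which the claim fails: inversion of moves is an involution, $(\gamma^{-1})^{-1}=\gamma$, and $\gamma^{-1}(\gamma(\eta))=\eta$ also whenever $R(\eta,\gamma,\delta)>0$. Expectations are assumed to converge where written. *)

(* Defs.v *)
From HB Require Import structures.
From Stdlib Require Import Relation_Operators.
From mathcomp Require Import all_boot all_order all_algebra.
From mathcomp Require Import mathcomp_extra boolp classical_sets functions.
From mathcomp Require Import reals ereal numfun esum exp.

Set Implicit Arguments.
Unset Strict Implicit.
Unset Printing Implicit Defensive.
Import Order.TTheory GRing.Theory Num.Theory.
Local Open Scope classical_set_scope.
Local Open Scope ring_scope.

Section sums.
Context {R : realType} {T : choiceType}.

Definition abs_summable (F : T -> R) : Prop := summable [set: T] (EFin \o F).

(* The sum of F over T; meaningful when F is abs_summable. *)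
Definition tsum (F : T -> R) : R :=
  fine (\esum_(t in [set: T]) (EFin \o F)^\+ t -
        \esum_(t in [set: T]) (EFin \o F)^\- t)%E.

Definition bounded_fct (F : T -> R) : Prop := exists M, forall t, `|F t| <= M.

Definition bounded_pos (F : T -> R) : Prop :=
  exists m M, 0 < m /\ forall t, m <= F t <= M.

Definition positive_fct (F : T -> R) : Prop := forall t, 0 < F t.

(* Probability measures on the countable set T are given by their masses. *)
Definition is_prob (p : T -> R) : Prop :=
  (forall t, 0 <= p t) /\ (\esum_(t in [set: T]) (p t)%:E = 1)%E.

Definition expect (p F : T -> R) : R := tsum (fun t => p t * F t).

(* p is finite and t ln t >= t - 1, so p-integrability of f ln f implies that of
   f when f > 0, and the first branch is meaningful. *)
Definition Ent (p f : T -> R) : \bar R :=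
  if `[< abs_summable (fun t => p t * (f t * ln (f t))) >]
  then (expect p (fun t => f t * ln (f t)) - expect p f * ln (expect p f))%:E
  else +oo%E.

End sums.

Section chain.
Context {R : realType} {S G : countType}.

(* The moves are the maps [act g]; [inv g] is the label of the move written
   g^{-1}. *)
Variables (act : G -> S -> S) (inv : G -> G).
Variables (p : S -> R) (c : S -> G -> R) (r : S -> G -> G -> R).
Implicit Types (f h : S -> R) (s : S) (g d : G).

Definition grad g f s : R := f (act g s) - f s.

Definition generator f s : R := tsum (fun g => c s g * grad g f s).

Definition logf f s : R := ln (f s).

Definition irreducible : Prop :=
  forall s t, clos_refl_trans S (fun x y => exists g, 0 < c x g /\ act g x = y) s t.

(* Inversion of moves is an involution: otherwise the detailed balance relation
   below, which only pairs g with inv g, would not make p reversible. *)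
Definition reversible : Prop :=
  [/\ involutive inv,
      forall g s, 0 < c s g -> act (inv g) (act g s) = s,
      forall g, abs_summable (fun s => p s * c s g) &
      forall g f, bounded_fct f ->
        expect p (fun s => c s g * f s) =
        expect p (fun s => c s (inv g) * f (act (inv g) s))].

(* -p[f L h], with the absolute convergence that makes it meaningful. *)
Definition dirichlet f h : R := - expect p (fun s => f s * generator h s).

Definition dirichlet_defined f h : Prop :=
  abs_summable (fun x : S * G => p x.1 * (f x.1 * (c x.1 x.2 * grad x.2 h x.1))).

(* The summand of (1/2) p[sum_g c grad_g f grad_g h]. *)
Definition energy_term f h s g : R := c s g * (grad g f s * grad g h s).

(* p[sum_{g,d} F(s,g,d)]; expect2_defined is absolute convergence, automatic when
   S is finite. *)
Definition expect2 (F : S -> G -> G -> R) : R :=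
  expect p (fun s => tsum (fun x : G * G => F s x.1 x.2)).

Definition expect2_defined (F : S -> G -> G -> R) : Prop :=
  abs_summable (fun x : S * (G * G) => p x.1 * F x.1 x.2.1 x.2.2).

Definition P1 : Prop := forall s g d, 0 < r s g d -> r s g d = r s d g.

(* Since both sides carry the weight r, the first clause makes both of them
   meaningful for every bounded psi. *)
Definition P2 : Prop :=
  expect2_defined r /\
  forall psi : S -> G -> G -> R,
    (exists M, forall s g d, `|psi s g d| <= M) ->
    expect2 (fun s g d => r s g d * psi s g d) =
    expect2 (fun s g d => r s g d * psi (act g s) (inv g) d).

Definition P3 : Prop :=
  forall s g d, 0 < r s g d -> act g (act d s) = act d (act g s).

Definition rate2 s g d : R := c s g * c s d.

Definition Gamma s g d : R := rate2 s g d - r s g d.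

(* W = Gamma gives the left-hand side of the assumed inequality; W = rate2 gives
   the expanded form of L f * L log f + (L f)^2 / f. *)
Definition bochner_term (W : S -> G -> G -> R) f s g d : R :=
  W s g d * (grad g f s * grad d (logf f) s + grad g f s * grad d f s / f s).

End chain.

(* Main.v *)
Require Import Defs.
From mathcomp Require Import all_boot all_order all_algebra.
From mathcomp Require Import mathcomp_extra boolp classical_sets functions.
From mathcomp Require Import reals ereal numfun esum exp.
From mathcomp Require Import cardinality fsbigop topology normedtype sequences.
From mathcomp Require Import ring lra.

Set Implicit Arguments.
Unset Strict Implicit.
Unset Printing Implicit Defensive.
Import Order.TTheory GRing.Theory Num.Theory.
Import numFieldNormedType.Exports.

Local Open Scope classical_set_scope.
Local Open Scope ring_scope.

(** Write E for the Dirichlet form, B(f) = pi[Lf L log f] + pi[(Lf)^2/f] and B_R(f) for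
    the expression obtained from the expansion of B(f) over pairs of moves when the weight
    c(s,g) c(s,d) is replaced by R(s,g,d).

    Bochner inequality. The hypothesis says kappa E(f, log f) <= B(f) - B_R(f), so the first
    claim amounts to B_R(f) >= 0 ([square_part_ge0]). By (P1), (P2) and (P3) the weight pi R
    is invariant under the symmetries of the square with corners s, gs, ds, gds. Averaging
    the integrand over them leaves an elementary inequality between the values of f at the
    four corners ([square_corners_ge0]), which follows from ln t >= 1 - 1/t. This argument
    needs f bounded away from 0 and infinity; truncating f decreases every summand in
    absolute value ([clamp_corner]), so dominated convergence gives the general case
    ([bochner_inequality]).

    Logarithmic Sobolev inequality. The classical argument differentiates along the
    semigroup P_t: the entropy decreases at rate E(P_t f, log P_t f), which itself decreases
    at rate B(P_t f) >= kappa E(P_t f, log P_t f), and everything vanishes as t grows. On an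
    infinite state space with unbounded rates the semigroup is avoided as follows. For
    l < kappa, let J(f) = l Ent(f) - E(f, log f), on the functions with values in a fixed
    band [m, M] and a fixed mean. An explicit Euler step f + t L_n f, where L_n keeps only the
    moves between states of exit rate at most n, stays in this set and raises J by at least
    t ((kappa - l) E(f, log f) - o(1)) ([entropy_step], [energy_step], [cut_bochner_close]).
    As J is bounded, such steps lead from any f to some f' with J(f') >= J(f) and
    E(f', log f') as small as desired. By irreducibility Ent(f') is then small too
    ([entropy_rigid]), so that J(f) <= 0 in the limit, and l tends to kappa ([band_mlsi]).

    The o(1) must be uniform in f, which requires the second moment pi[(sum_g c(s,g))^2] over
    the moves that do not fix s to be finite ([two_flow_summable]). The hypothesis only says
    that B - B_R converges for each single function bounded away from 0 and infinity; it is
    applied to one function with two values, constant on the classes of a colouring of the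
    states for which every state sends at least half of its rate to the other colour
    ([unfriendly]).

    Finally, the inequality passes from truncations of f to f, the entropy being shown finite
    along the way ([Ent_le_of_truncate]). *)

(** * Absolutely convergent sums *)

Section sum_theory.
Context {R : realType} {T : choiceType}.
Implicit Types F G H P N : T -> R.

Lemma abs_summableE F :
  abs_summable F = (\esum_(t in [set: T]) (`|F t|)%:E < +oo)%E.
Proof. by rewrite /abs_summable /summable. Qed.

Lemma abs_summable_le F G : (forall t, `|F t| <= `|G t|) ->
  abs_summable G -> abs_summable F.
Proof.
move=> FG; rewrite !abs_summableE; apply: le_lt_trans.
by apply: le_esum => t _; rewrite lee_fin.
Qed.

Lemma abs_summable_eq F G : F =1 G -> abs_summable G -> abs_summable F.
Proof. by move=> /funext ->. Qed.

Lemma abs_summable_abs F : abs_summable (fun t => `|F t|) <-> abs_summable F.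
Proof. by split; apply: abs_summable_le => t; rewrite normr_id. Qed.

Lemma abs_summableD F G : abs_summable F -> abs_summable G ->
  abs_summable (fun t => F t + G t).
Proof. by move=> sF sG; exact: (summableD sF sG). Qed.

Lemma abs_summableN F : abs_summable F -> abs_summable (fun t => - F t).
Proof. by apply: abs_summable_le => t; rewrite normrN. Qed.

Lemma abs_summableB F G : abs_summable F -> abs_summable G ->
  abs_summable (fun t => F t - G t).
Proof. by move=> sF sG; apply: abs_summableD => //; exact: abs_summableN. Qed.

Lemma abs_summable_bound F (M : R) :
  (forall s : seq T, uniq s -> \sum_(t <- s) `|F t| <= M) -> abs_summable F.
Proof.
move=> FM; rewrite abs_summableE; apply: (@le_lt_trans _ _ M%:E); last exact: ltry.
apply: ge_ereal_sup => _ [X [finX _] <-].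
by rewrite fsbig_finite//= sumEFin lee_fin FM.
Qed.

Lemma tsum_EFin F : (forall t, 0 <= F t) -> abs_summable F ->
  ((tsum F)%:E = \esum_(t in [set: T]) (F t)%:E)%E.
Proof.
move=> F0 sF.
have F0' x : [set: T] x -> (0 <= (EFin \o F) x)%E by rewrite lee_fin.
rewrite /tsum (eq_esum (b := EFin \o F)); last first.
  by move=> t _; rewrite (ge0_funeposE F0')// inE.
rewrite [X in (_ - X)%E](esum1); last first.
  by move=> t _; rewrite (ge0_funenegE F0')// inE.
rewrite sube0 fineK// ge0_fin_numE.
  by move: sF; rewrite abs_summableE; under eq_esum do rewrite ger0_norm//.
by apply: esum_ge0 => t _; rewrite lee_fin.
Qed.

(** Any splitting into non-negative summable parts computes the sum, which reduces
    signed identities to additivity of non-negative sums. *)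
Lemma tsum_diff P N : (forall t, 0 <= P t) -> (forall t, 0 <= N t) ->
  abs_summable P -> abs_summable N ->
  tsum (fun t => P t - N t) = tsum P - tsum N.
Proof.
move=> P0 N0 sP sN; apply: EFin_inj.
rewrite EFinB (tsum_EFin P0)// (tsum_EFin N0)//.
rewrite -(@esumB _ _ [set: T] (EFin \o P) (EFin \o N)) //; last first.
- by move=> ? _; rewrite lee_fin.
- by move=> ? _; rewrite lee_fin.
have sPN : summable [set: T] (EFin \o (fun t => P t - N t)) by exact: abs_summableB.
rewrite /tsum fineK; last first.
  rewrite fin_numB; apply/andP; split; rewrite ge0_fin_numE ?esum_ge0//.
    by have := summable_funepos sPN; rewrite /summable; under eq_esum do rewrite gee0_abs//.
  by have := summable_funeneg sPN; rewrite /summable; under eq_esum do rewrite gee0_abs//.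
by [].
Qed.

Lemma tsum_ge0 F : (forall t, 0 <= F t) -> abs_summable F -> 0 <= tsum F.
Proof. by move=> F0 sF; rewrite -lee_fin tsum_EFin// esum_ge0// => t _; rewrite lee_fin. Qed.

Lemma ger0_tsumD F G : (forall t, 0 <= F t) -> (forall t, 0 <= G t) ->
  abs_summable F -> abs_summable G ->
  tsum (fun t => F t + G t) = tsum F + tsum G.
Proof.
move=> F0 G0 sF sG; apply: EFin_inj; rewrite EFinD !tsum_EFin//; last 2 first.
- by move=> t; rewrite addr_ge0.
- exact: abs_summableD.
by rewrite -esumD// => t _; rewrite lee_fin.
Qed.

Let pos F t : R := (`|F t| + F t) / 2.
Let neg F t : R := (`|F t| - F t) / 2.
Let pos_ge0 F t : 0 <= pos F t.
Proof. by rewrite divr_ge0// -lerBlDr sub0r ler_normr lexx orbT. Qed.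
Let neg_ge0 F t : 0 <= neg F t.
Proof. by rewrite divr_ge0// subr_ge0 ler_norm. Qed.
Let posnegE F : F = fun t => pos F t - neg F t.
Proof. by apply/funext => t; rewrite /pos /neg; lra. Qed.
Let pos_sum F : abs_summable F -> abs_summable (pos F).
Proof.
apply: abs_summable_le => t; rewrite ger0_norm//.
by rewrite ler_pdivrMr// mulr_natr mulr2n lerD2l ler_norm.
Qed.
Let neg_sum F : abs_summable F -> abs_summable (neg F).
Proof.
apply: abs_summable_le => t; rewrite ger0_norm//.
by rewrite ler_pdivrMr// mulr_natr mulr2n lerD2l ler_normr lexx orbT.
Qed.

Lemma tsumD F G : abs_summable F -> abs_summable G ->
  tsum (fun t => F t + G t) = tsum F + tsum G.
Proof.
move=> sF sG.
have sp := pos_sum sF; have sn := neg_sum sF.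
have sp' := pos_sum sG; have sn' := neg_sum sG.
transitivity (tsum (fun t => (pos F t + pos G t) - (neg F t + neg G t))).
  by congr tsum; apply/funext => t; rewrite /pos /neg; lra.
rewrite tsum_diff; try (by move=> t; rewrite addr_ge0); try exact: abs_summableD.
rewrite !ger0_tsumD// [X in _ = tsum X + _]posnegE [X in _ = _ + tsum X]posnegE.
by rewrite !tsum_diff//; lra.
Qed.

Lemma tsumN F : abs_summable F -> tsum (fun t => - F t) = - tsum F.
Proof.
move=> sF; have sp := pos_sum sF; have sn := neg_sum sF.
transitivity (tsum (fun t => neg F t - pos F t)).
  by congr tsum; apply/funext => t; rewrite /pos /neg; lra.
by rewrite [X in _ = - tsum X]posnegE !tsum_diff// opprB.
Qed.

Lemma tsumB F G : abs_summable F -> abs_summable G ->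
  tsum (fun t => F t - G t) = tsum F - tsum G.
Proof. by move=> sF sG; rewrite tsumD ?tsumN//; exact: abs_summableN. Qed.

Lemma ler_tsum F G : abs_summable F -> abs_summable G ->
  (forall t, F t <= G t) -> tsum F <= tsum G.
Proof.
move=> sF sG FG; rewrite -subr_ge0 -tsumB//; apply: tsum_ge0.
  by move=> t; rewrite subr_ge0.
exact: abs_summableB.
Qed.

Lemma ler_norm_tsum F : abs_summable F -> `|tsum F| <= tsum (fun t => `|F t|).
Proof.
move=> sF; have sA := (abs_summable_abs F).2 sF.
rewrite ler_norml -tsumN//; apply/andP; split; apply: ler_tsum => //.
- exact: abs_summableN.
- by move=> t; rewrite lerNl ler_normr lexx orbT.
- by move=> t; rewrite ler_norm.
Qed.

Lemma tsum_finite_le F (s : seq T) : (forall t, 0 <= F t) -> abs_summable F ->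
  uniq s -> \sum_(t <- s) F t <= tsum F.
Proof.
move=> F0 sF us; rewrite -lee_fin tsum_EFin// -sumEFin.
apply: ereal_sup_ubound; exists [set` s] => //=.
by rewrite -fsbig_seq.
Qed.

Lemma tsum_sup F (e : R) : (forall t, 0 <= F t) -> abs_summable F -> 0 < e ->
  exists2 s : seq T, uniq s & tsum F - e < \sum_(t <- s) F t.
Proof.
move=> F0 sF e0.
have : ((tsum F - e)%:E < \esum_(t in [set: T]) (F t)%:E)%E.
  by rewrite -tsum_EFin// lte_fin ltrBlDr ltrDl.
move=> /ereal_sup_gt[_ [X [finX _] <-]].
rewrite fsbig_finite//= sumEFin lte_fin => h.
by exists (finmap.enum_fset (fset_set X)) => //; exact: finmap.fset_uniq.
Qed.

Lemma tsum_le_bound F (M : R) : (forall t, 0 <= F t) -> abs_summable F ->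
  (forall s : seq T, uniq s -> \sum_(t <- s) F t <= M) -> tsum F <= M.
Proof.
move=> F0 sF FM; apply/ler_addgt0Pr => e e0.
have [s us /ltW] := tsum_sup F0 sF e0; rewrite lerBlDr => /le_trans; apply.
by rewrite lerD2r FM.
Qed.

Lemma abs_summableZ F (k : R) : abs_summable F -> abs_summable (fun t => k * F t).
Proof.
move=> sF; have sA := (abs_summable_abs F).2 sF.
apply: (@abs_summable_bound _ (`|k| * tsum (fun t => `|F t|))) => s us.
under eq_bigr do rewrite normrM; rewrite -mulr_sumr ler_wpM2l//.
exact: tsum_finite_le.
Qed.

Let tsumZ_ge0 F (k : R) : 0 < k -> (forall t, 0 <= F t) -> abs_summable F ->
  tsum (fun t => k * F t) = k * tsum F.
Proof.
move=> k0 F0 sF; apply/eqP; rewrite eq_le; apply/andP; split.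
  apply: tsum_le_bound => [t||s us]; first by rewrite mulr_ge0// ltW.
    exact: abs_summableZ.
  by rewrite -mulr_sumr ler_wpM2l ?(ltW k0)//; exact: tsum_finite_le.
rewrite -ler_pdivlMl//; apply: tsum_le_bound => // s us.
rewrite ler_pdivlMl// mulr_sumr; apply: tsum_finite_le => //.
  by move=> t; rewrite mulr_ge0// ltW.
exact: abs_summableZ.
Qed.

Lemma abs_summable0 : abs_summable (fun _ : T => 0 : R).
Proof. by apply: (@abs_summable_bound _ 0) => s _; rewrite big1// => *; rewrite normr0. Qed.

Lemma tsum0 : tsum (fun _ : T => 0 : R) = 0.
Proof. by apply: EFin_inj; rewrite tsum_EFin ?esum1//; exact: abs_summable0. Qed.

Lemma tsumZ F (k : R) : abs_summable F -> tsum (fun t => k * F t) = k * tsum F.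
Proof.
wlog k0 : F k / 0 < k => [H sF|sF].
  have [k0|k0|->] := ltrgt0P k; first exact: H.
    have := H (fun t => - F t) (- k); rewrite oppr_gt0 => /(_ k0 (abs_summableN sF)).
    rewrite tsumN// mulrNN => <-; congr tsum; apply/funext => t.
    by rewrite mulrNN.
  by rewrite mul0r -[RHS]tsum0; congr tsum; apply/funext => t; rewrite mul0r.
have sp := pos_sum sF; have sn := neg_sum sF.
transitivity (tsum (fun t => k * pos F t - k * neg F t)).
  by congr tsum; apply/funext => t; rewrite /pos /neg; lra.
rewrite tsum_diff; try (by move=> t; rewrite mulr_ge0// ltW); try exact: abs_summableZ.
by rewrite !tsumZ_ge0// -mulrBr -tsum_diff// -posnegE.
Qed.

Lemma tsum_single F (x : T) : (forall t, t != x -> F t = 0) ->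
  abs_summable F /\ tsum F = F x.
Proof.
move=> Fx.
have sF : abs_summable F.
  apply: (@abs_summable_bound _ `|F x|) => s us.
  have [xs|xs] := boolP (x \in s).
    rewrite (bigD1_seq x)//= big1 ?addr0// => t tx.
    by rewrite Fx ?normr0.
  rewrite big_seq big1// => t ts; rewrite Fx ?normr0//.
  by apply: contraNneq xs => <-.
split=> //.
wlog F0 : F Fx sF / 0 <= F x => [H|].
  have [F0|F0] := leP 0 (F x); first exact: H.
  apply: oppr_inj; rewrite -tsumN//; apply: H => [t tx||].
  - by rewrite Fx ?oppr0.
  - exact: abs_summableN.
  - by rewrite oppr_ge0 ltW.
have F0' t : 0 <= F t by have [->//|/Fx->] := eqVneq t x.
apply/eqP; rewrite eq_le; apply/andP; split; last first.
  by have := @tsum_finite_le F [:: x] F0' sF; rewrite big_seq1; apply.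
apply: tsum_le_bound => // s us.
have [xs|xs] := boolP (x \in s).
  by rewrite (bigD1_seq x)//= big1 ?addr0// => t tx; rewrite Fx.
rewrite big_seq big1// => t ts; rewrite Fx//.
by apply: contraNneq xs => <-.
Qed.

Lemma tsum_term_le F x : (forall t, 0 <= F t) -> abs_summable F -> F x <= tsum F.
Proof.
by move=> F0 sF; have := @tsum_finite_le F [:: x] F0 sF; rewrite big_seq1; apply.
Qed.

(** The finitely many indices carrying all but a small part of the dominating sum
    are eventually all in the region where [F n] has stabilised. *)
Lemma tsum_dominated (F : nat -> T -> R) H G : abs_summable G ->
  (forall n t, `|F n t| <= G t) -> (forall t, \forall n \near \oo, F n t = H t) ->
  (tsum (F n) @[n --> \oo] --> tsum H).
Proof.
move=> sG FG FH.
have G0 t : 0 <= G t by exact: le_trans (FG 0%N t).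
have HG t : `|H t| <= G t.
  by have /filter_ex[n <-] := FH t.
have sF n : abs_summable (F n).
  by apply: abs_summable_le sG => t; rewrite [leRHS]ger0_norm.
have sH : abs_summable H.
  by apply: abs_summable_le sG => t; rewrite [leRHS]ger0_norm.
apply/cvgrPdist_le => e e0.
have e4 : 0 < e / 2 by rewrite divr_gt0.
have [s us hs] := tsum_sup G0 sG e4.
have : \forall n \near \oo, forall t, t \in s -> F n t = H t.
  elim: s {us hs} => [|x s IH]; first by near=> n.
  near=> n => t; rewrite inE => /orP[/eqP->|ts].
    by near: n; exact: FH.
  by move: t ts; near: n; exact: IH.
apply: filterS => n Fs.
rewrite -tsumB//; apply: le_trans (ler_norm_tsum _) _; first exact: abs_summableB.
(* Outside [s], where [F n] and [H] may differ, the dominating sum is small. *)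
pose I t := if t \in s then 0 else G t.
have IG t : I t <= G t by rewrite /I; case: ifP.
have I0 t : 0 <= I t by rewrite /I; case: ifP.
have sI : abs_summable I.
  by apply: abs_summable_le sG => t; rewrite !ger0_norm.
apply: (@le_trans _ _ (tsum (fun t => 2 * I t))).
  apply: ler_tsum; [|exact: abs_summableZ|].
    by apply/abs_summable_abs; exact: abs_summableB.
  move=> t; rewrite /I; case: ifPn => ts; first by rewrite Fs// subrr normr0 mulr0.
  by apply: le_trans (ler_normB _ _) _; have := FG n t; have := HG t; lra.
rewrite tsumZ// -ler_pdivlMl// mulrC.
have GI : tsum G = tsum I + tsum (fun t => G t - I t).
  rewrite -tsumD//; last exact: abs_summableB.
  by congr tsum; apply/funext => t; lra.
suff : \sum_(t <- s) G t <= tsum (fun t => G t - I t) by lra.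
apply: (@le_trans _ _ (\sum_(t <- s) (G t - I t))).
  rewrite big_seq [leRHS]big_seq; apply: ler_sum => t ts.
  by rewrite /I ts subr0.
apply: tsum_finite_le => //; last exact: abs_summableB.
by move=> t; rewrite subr_ge0.
Unshelve. all: by end_near.
Qed.

End sum_theory.

Lemma abs_summable_bounded (R : realType) (T : choiceType) (w F : T -> R) K :
  abs_summable w -> (forall t, `|F t| <= K) -> abs_summable (fun t => w t * F t).
Proof.
move=> sw FK; have := abs_summableZ K sw; apply: abs_summable_le => t.
rewrite normrM [leRHS]normrM mulrC ler_wpM2r//.
by apply: le_trans (FK t) _; exact: ler_norm.
Qed.

Lemma abs_summable_mask (R : realType) (T : choiceType) (P : pred T) (F : T -> R) :
  abs_summable F -> abs_summable (fun t => F t * (P t)%:R).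
Proof.
move=> sF; apply: (@abs_summable_bounded _ _ _ _ 1 sF) => t.
by case: (P t); rewrite ?normr0 ?normr1.
Qed.

Lemma tsum_tail (R : realType) (T : choiceType) (F : T -> R) (e : R) :
  (forall t, 0 <= F t) -> abs_summable F -> 0 < e ->
  exists D : seq T, [/\ uniq D, tsum F - e < \sum_(t <- D) F t &
    tsum (fun t => F t * (t \notin D)%:R) <= e].
Proof.
move=> F0 sF e0; have [D uD hD] := tsum_sup F0 sF e0; exists D; split => //.
have sub (P : pred T) := abs_summable_mask P sF.
have E : tsum F = tsum (fun t => F t * (t \in D)%:R) + tsum (fun t => F t * (t \notin D)%:R).
  rewrite -tsumD//; congr tsum; apply/funext => t.
  by case: (t \in D) => /=; rewrite ?mulr0 ?mulr1 ?addr0 ?add0r.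
suff : \sum_(t <- D) F t <= tsum (fun t => F t * (t \in D)%:R) by lra.
apply: le_trans (tsum_finite_le (F := fun t => F t * (t \in D)%:R) _ _ uD) => //.
  by rewrite big_seq [leRHS]big_seq; apply: ler_sum => t ->; rewrite mulr1.
by move=> t; rewrite mulr_ge0.
Qed.

(** * Change of variables and iterated sums *)

Lemma abs_summable_comp (R : realType) (T T' : choiceType) (e : T' -> T) (F : T -> R) :
  injective e -> abs_summable F -> abs_summable (F \o e).
Proof.
move=> inje sF.
apply: (@abs_summable_bound _ _ _ (tsum (fun t => `|F t|))) => s us.
rewrite -(big_map e predT (fun t => `|F t|)) tsum_finite_le//.
  exact/abs_summable_abs.
by rewrite map_inj_uniq.
Qed.

Lemma tsum_bij (R : realType) (T T' : choiceType) (e : T' -> T) (F : T -> R) :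
  bijective e -> tsum (F \o e) = tsum F.
Proof.
move=> [e' eK e'K].
have be : set_bij [set: T'] [set: T] e.
  split => // [x y _ _ exy|t _]; first by rewrite -[x]eK exy eK.
  by exists (e' t).
rewrite /tsum [in RHS](reindex_esum _ _ _ _ be) [X in _ = fine (_ - X)](reindex_esum _ _ _ _ be).
by congr (fine (_ - _)); apply: eq_esum => t _; rewrite ?funeposE ?funenegE.
Qed.

Section involution.
Context {R : realType} {T : choiceType} (th : T -> T) (w : T -> R).
Hypothesis w_th : forall t, w t != 0 -> th (th t) = t /\ w (th t) = w t.

Let th' t := if w t == 0 then t else th t.

Let th'K : involutive th'.
Proof.
move=> t; rewrite /th'; case: (eqVneq (w t) 0) => [->|wt]; first by rewrite eqxx.
by have [-> ->] := w_th wt; rewrite (negPf wt).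
Qed.

Let wth' (H : T -> R) : (fun t => w t * H (th t)) = (fun t => w t * H t) \o th'.
Proof.
apply/funext => t /=; rewrite /th'; case: (eqVneq (w t) 0) => [->|wt].
  by rewrite !mul0r.
by have [_ ->] := w_th wt.
Qed.

(** [th] need only be an involution where the weight charges, since there it can be
    completed by the identity to a bijection. *)
Lemma tsum_involution (H : T -> R) :
  tsum (fun t => w t * H (th t)) = tsum (fun t => w t * H t).
Proof. by rewrite wth'; apply: tsum_bij; exists th'. Qed.

Lemma abs_summable_involution (H : T -> R) :
  abs_summable (fun t => w t * H t) -> abs_summable (fun t => w t * H (th t)).
Proof. by rewrite wth'; apply: abs_summable_comp; exact: inv_inj th'K. Qed.

End involution.

Section fubini.
Context {R : realType} {A B : choiceType}.
Implicit Types F : A * B -> R.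

Let pair_esum (F : A * B -> \bar R) : (forall x, (0 <= F x)%E) ->
  (\esum_(x in [set: A * B]) F x =
   \esum_(a in [set: A]) \esum_(b in [set: B]) F (a, b))%E.
Proof.
move=> F0; rewrite esum_esum//.
rewrite (_ : [set: A] `*`` _ = [set: A * B]); last by apply/seteqP; split.
by apply: eq_esum => -[].
Qed.

Lemma abs_summable_row F a : abs_summable F -> abs_summable (fun b => F (a, b)).
Proof.
by move=> sF; apply: (@abs_summable_comp _ _ _ (fun b => (a, b)) F) => // ? ? [].
Qed.

Lemma abs_summable_tsum_row F : abs_summable F ->
  abs_summable (fun a => tsum (fun b => `|F (a, b)|)).
Proof.
move=> sF; have sA := (abs_summable_abs F).2 sF.
rewrite abs_summableE (eq_esum (b := fun a => \esum_(b in [set: B]) (`|F (a, b)|)%:E)).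
  by rewrite -(pair_esum (F := fun x => (`|F x|)%:E))//.
move=> a _; have sr := abs_summable_row a sA.
by rewrite ger0_norm ?tsum_EFin// tsum_ge0.
Qed.

Lemma abs_summable_pair F : (forall a, abs_summable (fun b => F (a, b))) ->
  abs_summable (fun a => tsum (fun b => `|F (a, b)|)) -> abs_summable F.
Proof.
move=> sr sF; rewrite abs_summableE (pair_esum (F := fun x => (`|F x|)%:E))//.
rewrite abs_summableE in sF; apply: le_lt_trans sF.
apply: le_esum => a _; rewrite -tsum_EFin//; last by apply/abs_summable_abs.
by rewrite lee_fin ler_norm.
Qed.

Let tsum_pair_ge0 F : (forall x, 0 <= F x) -> abs_summable F ->
  tsum F = tsum (fun a => tsum (fun b => F (a, b))).
Proof.
move=> F0 sF.
have sr a := abs_summable_row a sF.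
apply: EFin_inj; rewrite !tsum_EFin//.
- rewrite pair_esum => [|x]; last by rewrite lee_fin.
  by apply: eq_esum => a _; rewrite tsum_EFin.
- by move=> a; exact: tsum_ge0.
- have := abs_summable_tsum_row sF; apply: abs_summable_eq => a.
  by congr tsum; apply/funext => b; rewrite ger0_norm.
Qed.

Lemma abs_summable_tsum F : abs_summable F ->
  abs_summable (fun a => tsum (fun b => F (a, b))).
Proof.
move=> sF; have := abs_summable_tsum_row sF; apply: abs_summable_le => a.
have sr := abs_summable_row a sF.
rewrite [leRHS]ger0_norm; first exact: ler_norm_tsum.
by apply: tsum_ge0 => //; apply/abs_summable_abs.
Qed.

(** Adding |F| to F gives a difference of two non-negative families, for which the
    exchange is a fact about suprema. *)
Lemma tsum_pair F : abs_summable F ->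
  tsum F = tsum (fun a => tsum (fun b => F (a, b))).
Proof.
move=> sF; have sA := (abs_summable_abs F).2 sF.
pose P x := `|F x| + F x; pose N x := `|F x|.
have P0 x : 0 <= P x by rewrite /P -lerBlDr sub0r ler_normr lexx orbT.
have sP : abs_summable P by exact: abs_summableD.
transitivity (tsum P - tsum N).
  by rewrite -tsumB//; congr tsum; apply/funext => x; rewrite /P /N; lra.
rewrite !tsum_pair_ge0 ?/N// -tsumB; [|exact: (abs_summable_tsum sP)|exact: (abs_summable_tsum sA)].
congr tsum; apply/funext => a; rewrite -tsumB; [|exact: abs_summable_row|].
  by congr tsum; apply/funext => b; rewrite /P; lra.
exact: (@abs_summable_row (fun x => `|F x|)).
Qed.

End fubini.

Section weighted.
Context {R : realType} {A B : choiceType} (p : A -> R).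
Hypothesis p_gt0 : forall a, 0 < p a.
Implicit Types F : A -> B -> R.

Lemma abs_summable_weighted F a :
  abs_summable (fun x : A * B => p x.1 * F x.1 x.2) -> abs_summable (F a).
Proof.
move=> sF; have /= := abs_summableZ (p a)^-1 (abs_summable_row a sF).
by apply: abs_summable_eq => b; rewrite mulKf// gt_eqF.
Qed.

Lemma expect_tsum F : abs_summable (fun x : A * B => p x.1 * F x.1 x.2) ->
  expect p (fun a => tsum (F a)) = tsum (fun x : A * B => p x.1 * F x.1 x.2).
Proof.
move=> sF; rewrite tsum_pair//; congr tsum; apply/funext => a /=.
by rewrite tsumZ//; exact: abs_summable_weighted.
Qed.

Lemma abs_summable_expect F : abs_summable (fun x : A * B => p x.1 * F x.1 x.2) ->
  abs_summable (fun a => p a * tsum (F a)).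
Proof.
move=> sF; have := abs_summable_tsum sF; apply: abs_summable_eq => a /=.
by rewrite tsumZ//; exact: abs_summable_weighted.
Qed.

End weighted.

Section product.
Context {R : realType} {A B : choiceType} (F : A -> R) (G : B -> R).
Hypotheses (sF : abs_summable F) (sG : abs_summable G).

Lemma abs_summable_prod : abs_summable (fun x : A * B => F x.1 * G x.2).
Proof.
apply: abs_summable_pair => [a|] /=; first exact: abs_summableZ.
have := abs_summableZ (tsum (fun b => `|G b|)) ((abs_summable_abs F).2 sF).
apply: abs_summable_eq => a; rewrite mulrC -tsumZ; last exact/abs_summable_abs.
by congr tsum; apply/funext => b; rewrite normrM.
Qed.

Lemma tsum_prod : tsum (fun x : A * B => F x.1 * G x.2) = tsum F * tsum G.
Proof.
rewrite tsum_pair; last exact: abs_summable_prod.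
rewrite [RHS]mulrC -tsumZ//; congr tsum; apply/funext => a /=.
by rewrite tsumZ// mulrC.
Qed.

End product.

Lemma abs_summable_factor (R : realType) (A B : choiceType) (F : A -> R) (G : B -> R) b :
  G b != 0 -> abs_summable (fun x : A * B => F x.1 * G x.2) -> abs_summable F.
Proof.
move=> Gb sFG.
have inj : injective (fun a : A => (a, b)) by move=> ? ? [].
have := abs_summableZ (G b)^-1 (abs_summable_comp inj sFG).
by apply: abs_summable_eq => a /=; rewrite mulrCA mulVf// mulr1.
Qed.

Lemma tsum_exchange (R : realType) (A B : choiceType) (F : A * B -> R) :
  abs_summable F ->
  tsum (fun b => tsum (fun a => F (a, b))) = tsum (fun a => tsum (fun b => F (a, b))).
Proof.
move=> sF; pose e (x : B * A) := (x.2, x.1).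
have be : bijective e by exists (fun x => (x.2, x.1)) => -[].
have sFe : abs_summable (F \o e) by apply: abs_summable_comp sF; exact: bij_inj.
by rewrite -[RHS]tsum_pair// -(tsum_bij _ be) [in RHS]tsum_pair.
Qed.

(** * Reversibility as summation by parts *)

Section chain.
Context {R : realType} {S G : countType} (act : G -> S -> S) (inv : G -> G).
Context (p : S -> R) (c : S -> G -> R).

(** Discarding the moves that fix a state changes neither the generator nor the
    Dirichlet form, and is necessary for what follows: the assumptions give no
    control on the total rate of such moves. *)
Definition jump_rate s g : R := c s g * (act g s != s)%:R.

Definition flow (x : S * G) : R := p x.1 * jump_rate x.1 x.2.

Definition rev_edge (x : S * G) : S * G := (act x.2 x.1, inv x.2).

Lemma rate_grad s g (f : S -> R) : c s g * grad act g f s = jump_rate s g * grad act g f s.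
Proof.
rewrite /jump_rate /grad; case: (eqVneq (act g s) s) => [->|_].
  by rewrite subrr !mulr0.
by rewrite mulr1.
Qed.

Lemma energy_flow (f h : S -> R) x :
  p x.1 * energy_term act c f h x.1 x.2 =
  flow x * (grad act x.2 f x.1 * grad act x.2 h x.1).
Proof. by rewrite /energy_term (mulrA (c _ _)) rate_grad /flow; ring. Qed.

Context (p_prob : is_prob p) (c_ge0 : forall s g, 0 <= c s g).

Lemma jump_rate_ge0 s g : 0 <= jump_rate s g.
Proof. by rewrite mulr_ge0. Qed.

Lemma p_ge0 s : 0 <= p s. Proof. by case: p_prob. Qed.

Lemma flow_ge0 x : 0 <= flow x.
Proof. by rewrite mulr_ge0// ?p_ge0// jump_rate_ge0. Qed.

Lemma p_summable : abs_summable p.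
Proof.
rewrite abs_summableE (eq_esum (b := fun t => (p t)%:E)) => [|t _].
  by case: p_prob => _ ->; exact: ltry.
by rewrite ger0_norm// p_ge0.
Qed.

Lemma tsum_p : tsum p = 1.
Proof.
apply: EFin_inj; rewrite tsum_EFin; [by case: p_prob|exact: p_ge0|exact: p_summable].
Qed.

Lemma p_mul_summable (F : S -> R) M : (forall s, `|F s| <= M) ->
  abs_summable (fun s => p s * F s).
Proof. exact: abs_summable_bounded p_summable. Qed.

Context (c_rev : reversible act inv p c).

(** Testing the reversibility condition with the indicator of a state makes it
    pointwise: since inversion is involutive, the only state that the inverse move sends
    to [s] with positive rate is [act g s]. *)
Lemma detailed_balance s g : 0 < c s g ->
  p (act g s) * c (act g s) (inv g) = p s * c s g.
Proof.
move=> csg; case: c_rev => invK invA _ rev.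
have bI : bounded_fct (fun t => (t == s)%:R : R).
  by exists 1 => t; case: eqP; rewrite ?normr0 ?normr1.
have := rev g _ bI; rewrite /expect.
have F0 t : t != s -> p t * (c t g * (t == s)%:R) = 0.
  by move=> /negPf ->; rewrite !mulr0.
have F'0 t : t != act g s -> p t * (c t (inv g) * (act (inv g) t == s)%:R) = 0.
  move=> ts; case: eqP => [ats|_]; last by rewrite !mulr0.
  have := c_ge0 t (inv g); rewrite le_eqVlt => /orP[/eqP<-|/invA].
    by rewrite mul0r mulr0.
  by rewrite invK ats => tE; rewrite -tE eqxx in ts.
rewrite (tsum_single F0).2 (tsum_single F'0).2.
by rewrite invA// !eqxx !mulr1.
Qed.

Lemma flow_rev x : flow x != 0 ->
  rev_edge (rev_edge x) = x /\ flow (rev_edge x) = flow x.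
Proof.
case: x => s g; rewrite /flow /rev_edge /jump_rate /= => fx.
have csg : 0 < c s g.
  rewrite lt_neqAle c_ge0 andbT eq_sym; apply: contraNneq fx => ->.
  by rewrite mul0r mulr0.
have invA : act (inv g) (act g s) = s by case: c_rev => _ + _ _; apply.
split; first by rewrite invA; case: c_rev => ->.
by rewrite invA mulrA detailed_balance// mulrA [s == _]eq_sym.
Qed.

(** Reversibility in the form used throughout: summation by parts against any weight
    on the edges that is symmetric under reversal. *)
Lemma sum_by_parts (w : S * G -> R) (f h : S -> R) :
  (forall x, w x != 0 -> rev_edge (rev_edge x) = x /\ w (rev_edge x) = w x) ->
  abs_summable (fun x => w x * (f x.1 * grad act x.2 h x.1)) ->
  abs_summable (fun x => w x * (grad act x.2 f x.1 * grad act x.2 h x.1)) /\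
  tsum (fun x => w x * (f x.1 * grad act x.2 h x.1)) =
  - (2^-1 * tsum (fun x => w x * (grad act x.2 f x.1 * grad act x.2 h x.1))).
Proof.
move=> w_rev; pose H (x : S * G) := f x.1 * grad act x.2 h x.1.
move=> sH; have sH' := abs_summable_involution w_rev sH.
have EH x : w x * (grad act x.2 f x.1 * grad act x.2 h x.1) =
            - (w x * H x + w x * H (rev_edge x)).
  have [->|/w_rev[]] := eqVneq (w x) 0; first by rewrite !mul0r addr0 oppr0.
  case: x => s g /=; rewrite /rev_edge /= => -[E _] _.
  by rewrite /H /grad /= E; ring.
split.
  by apply: (abs_summable_eq EH); apply: abs_summableN; exact: abs_summableD.
rewrite (funext EH) tsumN; last exact: abs_summableD.
by rewrite tsumD// (tsum_involution w_rev); lra.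
Qed.

Context (c_irr : irreducible act c).

(** Detailed balance carries positive mass along each edge of positive rate. *)
Lemma p_gt0 s : 0 < p s.
Proof.
have [s0 ps0] : exists s0, 0 < p s0.
  apply: contrapT => /forallNP p0.
  have : (\esum_(t in [set: S]) (p t)%:E = 0)%E.
    apply: esum1 => t _; congr (_%:E); apply/eqP; rewrite eq_le p_ge0 andbT.
    by rewrite leNgt; apply/negP.
  by case: p_prob => _ -> /eqP; rewrite onee_eq0.
suff H x y : Relation_Operators.clos_refl_trans S
    (fun x y => exists g, 0 < c x g /\ act g x = y) x y -> 0 < p x -> 0 < p y.
  exact: H (c_irr s0 s) ps0.
elim=> {x y} [x y [g [cxg <-]] px|//|x y z _ xy _ yz px]; last exact/yz/xy.
have := mulr_gt0 px cxg; rewrite -detailed_balance// => /gt_eqF/negP h.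
by rewrite lt_neqAle p_ge0 andbT; apply/eqP => p0; apply: h; rewrite -p0 mul0r.
Qed.

Lemma dirichlet_energy (f h : S -> R) : positive_fct f ->
  dirichlet_defined act p c f h ->
  abs_summable (fun x => flow x * (grad act x.2 f x.1 * grad act x.2 h x.1)) /\
  dirichlet act p c f h =
  2^-1 * tsum (fun x => flow x * (grad act x.2 f x.1 * grad act x.2 h x.1)).
Proof.
move=> f0 def.
have HE x : p x.1 * (f x.1 * (c x.1 x.2 * grad act x.2 h x.1)) =
            flow x * (f x.1 * grad act x.2 h x.1).
  by rewrite rate_grad /flow; ring.
have sH : abs_summable (fun x => flow x * (f x.1 * grad act x.2 h x.1)).
  by move: def; apply: abs_summable_eq => x; rewrite HE.
have [sE E] := sum_by_parts flow_rev sH; split=> //.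
rewrite -[RHS]opprK -E /dirichlet; congr (- _).
rewrite -(funext HE) -(expect_tsum p_gt0 (F := fun s g => f s * (c s g * grad act g h s)))//.
congr tsum; apply/funext => s; congr (_ * _).
rewrite /generator -tsumZ//.
have := abs_summableZ (f s)^-1 (abs_summable_weighted p_gt0
    (F := fun s g => f s * (c s g * grad act g h s)) s def).
by apply: abs_summable_eq => g; rewrite mulKf// gt_eqF.
Qed.

End chain.

(** * The square inequality *)

Lemma ln_le_sub1 (R : realType) (x : R) : 0 < x -> ln x <= x - 1.
Proof.
by move=> x0; have := @le_ln1Dx R (x - 1); rewrite addrCA subrr addr0; apply; lra.
Qed.

Lemma ln_ge_1subV (R : realType) (x : R) : 0 < x -> 1 - x^-1 <= ln x.
Proof.
move=> x0; have := @ln_le_sub1 R x^-1; rewrite invr_gt0 => /(_ x0).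
by rewrite lnV ?posrE//; lra.
Qed.

Section square.
Context {R : realType}.
Implicit Types a b c d : R.

(** [score a b] is minus the derivative in [a] of (b - a) (ln b - ln a). *)
Definition score a b : R := (ln b - ln a) + (b - a) / a.

(** The summand of the Bochner sums, as a function of the value [a] at a state and of the
    values [b] and [c] at its images under the two moves. *)
Definition corner a b c : R := (b - a) * score a c.

Definition sym_corner a b c : R := corner a b c + corner a c b.

(** With P = a + d, Q = b + c, X = ad and Y = bc, half the left-hand side is
    P (ln (X/Y) + Y/X - 1) + Q (ln (Y/X) + X/Y - 1), and ln t >= 1 - 1/t. *)
Lemma square_corners_ge0 a b c d : 0 < a -> 0 < b -> 0 < c -> 0 < d ->
  0 <= sym_corner a b c + sym_corner b a d + sym_corner c a d + sym_corner d b c.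
Proof.
move=> a0 b0 c0 d0.
have aN0 := lt0r_neq0 a0; have bN0 := lt0r_neq0 b0.
have cN0 := lt0r_neq0 c0; have dN0 := lt0r_neq0 d0.
pose L := ln a + ln d - ln b - ln c.
have lnq x y z t : 0 < x -> 0 < y -> 0 < z -> 0 < t ->
    ln (x * y / (z * t)) = ln x + ln y - ln z - ln t.
  move=> x0 y0 z0 t0; rewrite ln_div ?posrE ?mulr_gt0// !lnM ?posrE//; lra.
have L1 : 0 <= L - (1 - b * c / (a * d)).
  rewrite subr_ge0 /L -lnq//; have := @ln_ge_1subV R (a * d / (b * c)).
  by rewrite invf_div; apply; rewrite divr_gt0// mulr_gt0.
have L2 : 0 <= - L - (1 - a * d / (b * c)).
  have -> : - L = ln b + ln c - ln a - ln d by rewrite /L; lra.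
  rewrite subr_ge0 -lnq//; have := @ln_ge_1subV R (b * c / (a * d)).
  by rewrite invf_div; apply; rewrite divr_gt0// mulr_gt0.
have -> : sym_corner a b c + sym_corner b a d + sym_corner c a d + sym_corner d b c
    = 2 * ((a + d) * (L - (1 - b * c / (a * d))) +
           (b + c) * (- L - (1 - a * d / (b * c)))).
  by rewrite /sym_corner /corner /score /L; field; rewrite aN0 bN0 cN0 dN0.
by rewrite mulr_ge0// addr_ge0// mulr_ge0// addr_ge0// ltW.
Qed.

Lemma score_bound m M a b : 0 < m -> m <= a <= M -> m <= b <= M ->
  `|score a b| <= `|ln m| + `|ln M| + M / m.
Proof.
move=> m0 /andP[ma aM] /andP[mb bM].
have lnb x : m <= x -> x <= M -> ln m <= ln x <= ln M.
  by move=> mx xM; rewrite !ler_ln ?posrE ?mx//; lra.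
have /andP[la la'] := lnb _ ma aM; have /andP[lb lb'] := lnb _ mb bM.
have hM := ler_norm (ln M); have hm : - ln m <= `|ln m| by rewrite -normrN ler_norm.
have a0 : 0 < a by lra.
rewrite /score; apply: le_trans (ler_normD _ _) _; apply: lerD.
  by rewrite ler_norml; apply/andP; split; lra.
rewrite normrM normfV (gtr0_norm a0); apply: ler_pM => //.
- by rewrite invr_ge0 ltW.
- by rewrite ler_norml; apply/andP; split; lra.
- by rewrite lef_pV2 ?posrE.
Qed.

Lemma corner_bound m M a b c : 0 < m -> m <= a <= M -> m <= b <= M -> m <= c <= M ->
  `|corner a b c| <= M * (`|ln m| + `|ln M| + M / m).
Proof.
move=> m0 ha hb hc; rewrite /corner normrM ler_pM ?(score_bound m0)//.
by move: ha hb => /andP[? ?] /andP[? ?]; rewrite ler_norml; apply/andP; split; lra.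
Qed.

End square.

Section curvature.
Context {R : realType} {S G : countType} (act : G -> S -> S) (inv : G -> G).
Context (p : S -> R) (r : S -> G -> G -> R) (p_gt0 : forall s, 0 < p s).
Context (r_ge0 : forall s g d, 0 <= r s g d).
Context (r_inv : forall s g d, 0 < r s g d -> act (inv g) (act g s) = s).
Context (r_P1 : P1 r) (r_P2 : P2 act inv p r) (r_P3 : P3 act r).

Implicit Types (f : S -> R) (psi : S -> G -> G -> R) (x : S * (G * G)).

Definition bochner_corner f x : R :=
  corner (f x.1) (f (act x.2.1 x.1)) (f (act x.2.2 x.1)).

Lemma bochner_termE (W : S -> G -> G -> R) f x :
  p x.1 * bochner_term act W f x.1 x.2.1 x.2.2 =
  p x.1 * W x.1 x.2.1 x.2.2 * bochner_corner f x.
Proof. by rewrite /bochner_term /bochner_corner /corner /score /grad /logf; ring. Qed.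

Lemma expect2E (F : S -> G -> G -> R) : expect2_defined p F ->
  expect2 p F = tsum (fun x => p x.1 * F x.1 x.2.1 x.2.2).
Proof. exact: (expect_tsum p_gt0 (F := fun s gd => F s gd.1 gd.2)). Qed.

Let q x := p x.1 * r x.1 x.2.1 x.2.2.

Let q_ge0 x : 0 <= q x. Proof. by rewrite mulr_ge0// ltW. Qed.

Let sum_q psi : R := tsum (fun x => q x * psi x.1 x.2.1 x.2.2).

Definition bounded3 psi := exists M, forall s g d, `|psi s g d| <= M.

Let q_psi psi : bounded3 psi -> abs_summable (fun x => q x * psi x.1 x.2.1 x.2.2).
Proof.
move=> [M psiM]; case: r_P2 => sq _.
by apply: (abs_summable_bounded sq) => x; exact: psiM.
Qed.

Let sum_q_eq psi psi' :
  (forall s g d, 0 < r s g d -> psi s g d = psi' s g d) -> sum_q psi = sum_q psi'.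
Proof.
move=> E; congr tsum; apply/funext => -[s [g d]]; rewrite /q /=.
have := r_ge0 s g d; rewrite le_eqVlt => /orP[/eqP<-|/E ->//].
by rewrite mulr0 !mul0r.
Qed.

Let sum_q_swap psi : bounded3 psi -> sum_q (fun s g d => psi s d g) = sum_q psi.
Proof.
move=> bpsi; rewrite /sum_q.
pose e x := (x.1, (x.2.2, x.2.1)).
have be : bijective e by exists e => -[s [g d]].
rewrite -[RHS](tsum_bij _ be); congr tsum; apply/funext => -[s [g d]] /=.
rewrite /q /=; have := r_ge0 s g d; rewrite le_eqVlt => /orP[/eqP r0|/r_P1 -> //].
have := r_ge0 s d g; rewrite le_eqVlt => /orP[/eqP <-|/r_P1 ->]; by rewrite -r0 mulr0.
Qed.

Let sum_q_move psi : bounded3 psi ->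
  sum_q (fun s g d => psi (act g s) (inv g) d) = sum_q psi.
Proof.
move=> bpsi; case: r_P2 => _ /(_ psi bpsi).
have bpsi' : bounded3 (fun s g d => psi (act g s) (inv g) d).
  by case: bpsi => M psiM; exists M => s g d.
rewrite !expect2E /expect2_defined; last 2 first.
- by move: (q_psi bpsi'); apply: abs_summable_eq => x; rewrite mulrA.
- by move: (q_psi bpsi); apply: abs_summable_eq => x; rewrite mulrA.
have E psi' : tsum (fun x => p x.1 * (r x.1 x.2.1 x.2.2 * psi' x.1 x.2.1 x.2.2)) =
    sum_q psi' by congr tsum; apply/funext => x; rewrite mulrA.
by rewrite (E psi) (E (fun s g d => psi (act g s) (inv g) d)).
Qed.

(** The weight q = p r is invariant under (s, g, d) -> (s, d, g) and, by (P2), under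
    (s, g, d) -> (g s, g^-1, d); by (P3) these two generate the symmetries of the
    square with corners s, gs, ds, gds. *)
Lemma square_part_ge0 f m M : 0 < m -> (forall s, m <= f s <= M) ->
  0 <= tsum (fun x => p x.1 * r x.1 x.2.1 x.2.2 * bochner_corner f x).
Proof.
move=> m0 fmM.
have f0 s : 0 < f s by have := fmM s; lra.
pose psi1 s g d := sym_corner (f s) (f (act g s)) (f (act d s)).
pose psi2 s g d := sym_corner (f (act g s)) (f s) (f (act d (act g s))).
pose psi3 s g d := sym_corner (f (act d s)) (f s) (f (act d (act g s))).
pose psi4 s g d := sym_corner (f (act d (act g s))) (f (act g s)) (f (act d s)).
have b (u v w : S -> G -> G -> S) :
    bounded3 (fun s g d => sym_corner (f (u s g d)) (f (v s g d)) (f (w s g d))).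
  exists (M * (`|ln m| + `|ln M| + M / m) + M * (`|ln m| + `|ln M| + M / m)) => s g d.
  by apply: le_trans (ler_normD _ _) _; apply: lerD; exact: corner_bound.
have b1 : bounded3 psi1 by exact: b.
have b2 : bounded3 psi2 by exact: b.
have b3 : bounded3 psi3 by exact: b.
have b4 : bounded3 psi4 by exact: b.
have E12 : sum_q psi1 = sum_q psi2.
  rewrite -(sum_q_move b1); apply: sum_q_eq => s g d r0.
  by rewrite /psi1 /psi2 (r_inv r0).
have E23 : sum_q psi2 = sum_q psi3.
  rewrite -(sum_q_swap b2); apply: sum_q_eq => s g d r0.
  by rewrite /psi2 /psi3 (r_P3 r0).
have E34 : sum_q psi3 = sum_q psi4.
  rewrite -(sum_q_move b3); apply: sum_q_eq => s g d r0.
  by rewrite /psi3 /psi4 (r_inv r0).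
pose phi s g d := corner (f s) (f (act g s)) (f (act d s)).
have bphi : bounded3 phi.
  by exists (M * (`|ln m| + `|ln M| + M / m)) => s g d; exact: corner_bound.
have bphi' : bounded3 (fun s g d => phi s d g) by case: bphi => K h; exists K.
have E1 : sum_q psi1 = 2 * sum_q phi.
  rewrite mulr_natl mulr2n -{2}(sum_q_swap bphi) /sum_q.
  rewrite -tsumD; [|exact: q_psi|exact: (q_psi bphi')].
  by congr tsum; apply/funext => x; rewrite -mulrDr.
rewrite -[leRHS]/(sum_q phi).
suff : 0 <= sum_q psi1 + sum_q psi2 + sum_q psi3 + sum_q psi4 by lra.
have s1 := q_psi b1; have s2 := q_psi b2; have s3 := q_psi b3; have s4 := q_psi b4.
have s12 := abs_summableD s1 s2; have s123 := abs_summableD s12 s3.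
rewrite /sum_q -!tsumD//; apply: tsum_ge0; last exact: abs_summableD.
move=> x; rewrite -!mulrDr mulr_ge0//.
exact: square_corners_ge0.
Qed.

End curvature.

(** * Truncation *)

Section clamp.
Context {R : realType} (m M : R) (m_gt0 : 0 < m) (m_le_M : m <= M).
Implicit Types a b c : R.

Definition clamp a : R := Num.max m (Num.min a M).

Lemma clamp_itv a : m <= clamp a <= M.
Proof. by rewrite /clamp le_max lexx/= ge_max m_le_M ge_min lexx orbT. Qed.

Lemma clamp_id a : m <= a <= M -> clamp a = a.
Proof. by move=> /andP[ma aM]; rewrite /clamp min_l// max_r. Qed.

Lemma clamp_gt0 a : 0 < clamp a.
Proof. by have /andP[+ _] := clamp_itv a; apply: lt_le_trans. Qed.

Let clampP a : [\/ a <= m /\ clamp a = m, m <= a <= M /\ clamp a = a | M <= a /\ clamp a = M].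
Proof.
have [am|ma] := leP a m.
  by apply: Or31; rewrite /clamp min_l ?max_l//; exact: le_trans am _.
have [aM|Ma] := leP a M; first by apply: Or32; rewrite clamp_id ?(ltW ma) ?aM.
by apply: Or33; rewrite /clamp min_r ?max_r// ltW.
Qed.

Lemma clamp_homo a b : a <= b -> clamp a <= clamp b.
Proof.
by move=> ab; case: (clampP a) => -[? ->]; case: (clampP b) => -[? ->]; move: m_gt0 m_le_M => mg ml; lra.
Qed.

(** The quotient of [clamp x] by [x] is non-increasing, so that truncation also contracts
    ratios, hence differences of logarithms and relative differences. *)
Lemma clamp_ratio a b : 0 < a -> a <= b -> clamp b * a <= b * clamp a.
Proof.
by move=> a0 ab; case: (clampP a) => -[? ->]; case: (clampP b) => -[? ->]; move: m_gt0 m_le_M => mg ml; nra.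
Qed.

Lemma clamp_dist a b : `|clamp b - clamp a| <= `|b - a|.
Proof.
wlog ab : a b / a <= b => [H|].
  by have [/H//|/ltW/H] := leP a b; rewrite distrC [leRHS]distrC.
have cab := clamp_homo ab.
rewrite !ger0_norm ?subr_ge0//; move: cab.
by case: (clampP a) => -[? ->]; case: (clampP b) => -[? ->]; move: m_gt0 m_le_M => mg ml; lra.
Qed.

Lemma clamp_dist_ln a b : 0 < a -> 0 < b ->
  `|ln (clamp b) - ln (clamp a)| <= `|ln b - ln a|.
Proof.
wlog ab : a b / a <= b => [H a0 b0|a0 b0].
  have [/H|/ltW/H] := leP a b; first exact.
  by rewrite distrC [leRHS]distrC; apply.
have ca := clamp_gt0 a; have cb := clamp_gt0 b; have cab := clamp_homo ab.
rewrite !ger0_norm ?subr_ge0 ?ler_ln ?posrE//.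
have : ln (clamp b * a) <= ln (b * clamp a).
  by rewrite ler_ln ?posrE ?mulr_gt0// clamp_ratio.
by rewrite !lnM ?posrE//; lra.
Qed.

Lemma clamp_dist_rel a b : 0 < a -> 0 < b ->
  `|(clamp b - clamp a) / clamp a| <= `|(b - a) / a|.
Proof.
move=> a0 b0; have ca := clamp_gt0 a; have cb := clamp_gt0 b.
rewrite !normrM !normfV (gtr0_norm a0) (gtr0_norm ca).
rewrite ler_pdivrMr// mulrAC ler_pdivlMr//.
have [ab|/ltW ba] := leP a b.
  have cab := clamp_homo ab; rewrite !ger0_norm ?subr_ge0//.
  by have := clamp_ratio a0 ab; lra.
have cab := clamp_homo ba; rewrite !ler0_norm ?subr_le0//.
by have := clamp_ratio b0 ba; lra.
Qed.

End clamp.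

Section corner_norm.
Context {R : realType}.
Implicit Types a b c m M : R.

Lemma ln_secant a b : 0 < a -> 0 < b -> exists2 k, 0 <= k & ln b - ln a = k * (b - a).
Proof.
move=> a0 b0; have [->|ab] := eqVneq a b; first by exists 0; rewrite // !subrr mulr0.
exists ((ln b - ln a) / (b - a)); last by rewrite divfK// subr_eq0 eq_sym.
have [lab|ba] := ltP a b.
  by rewrite divr_ge0// subr_ge0 ?ler_ln ?posrE// ltW.
by rewrite -mulrNN -invrN !opprB divr_ge0// subr_ge0 ?ler_ln ?posrE.
Qed.

(** The two terms have the same sign, so that bounds on the sum bound each. *)
Lemma norm_corner a b c : 0 < a -> 0 < c ->
  `|corner a b c| = `|b - a| * (`|ln c - ln a| + `|(c - a) / a|).
Proof.
move=> a0 c0; rewrite /corner /score normrM; congr (_ * _).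
have [k k0 ->] := ln_secant a0 c0; have ai : 0 <= a^-1 by rewrite invr_ge0 ltW.
by rewrite [_ / a]mulrC -mulrDl !normrM (ger0_norm k0) (ger0_norm ai) ger0_norm ?addr_ge0// mulrDl.
Qed.

Lemma clamp_corner m M a b c : 0 < m -> m <= M -> 0 < a -> 0 < b -> 0 < c ->
  `|corner (clamp m M a) (clamp m M b) (clamp m M c)| <= `|corner a b c|.
Proof.
move=> m0 mM a0 b0 c0; rewrite !norm_corner ?clamp_gt0//.
apply: ler_pM => //; first exact: clamp_dist.
by apply: lerD; [exact: clamp_dist_ln|exact: clamp_dist_rel].
Qed.

End corner_norm.

Section truncation.
Context {R : realType} {S : countType} (f : S -> R) (f_gt0 : positive_fct f).

Definition truncate (N : nat) s : R := clamp N.+1%:R^-1 N.+1%:R (f s).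

Lemma trunc_lo N : 0 < N.+1%:R^-1 :> R. Proof. by rewrite invr_gt0. Qed.

Lemma trunc_lohi N : N.+1%:R^-1 <= N.+1%:R :> R.
Proof.
have h : 1 <= N.+1%:R :> R by rewrite ler1n.
by apply: (le_trans _ h); rewrite invf_le1.
Qed.

Lemma truncate_bounded N : bounded_pos (truncate N).
Proof.
exists N.+1%:R^-1, N.+1%:R; split; first exact: trunc_lo.
by move=> s; apply: clamp_itv; exact: trunc_lohi.
Qed.

Lemma truncate_near s : \forall N \near \oo, truncate N s = f s.
Proof.
near=> N; apply: clamp_id; apply/andP; split.
  rewrite -[f s]invrK lef_pV2 ?posrE ?invr_gt0//.
  apply: (@le_trans _ _ N%:R); last by rewrite ler_nat.
  by near: N; exact: nbhs_infty_ger.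
apply: (@le_trans _ _ N%:R); last by rewrite ler_nat.
by near: N; exact: nbhs_infty_ger.
Unshelve. all: by end_near.
Qed.

End truncation.

(** * The Bochner inequality *)

Section bochner.
Context {R : realType} {S G : countType} (act : G -> S -> S) (inv : G -> G).
Context (p : S -> R) (c : S -> G -> R) (r : S -> G -> G -> R) (kappa : R).
Context (p_gt0 : forall s, 0 < p s) (c_ge0 : forall s g, 0 <= c s g).

Implicit Types f h : S -> R.

Local Notation SGG := (S * (G * G))%type.

Local Notation jump := (jump_rate act c).

Definition energy_density f (x : S * G) : R :=
  grad act x.2 f x.1 * grad act x.2 (logf f) x.1.

(** Twice the Dirichlet form of [f] and its logarithm. *)
Definition energy f : R := tsum (fun x : S * G => flow act p c x * energy_density f x).

Definition energy_finite f : Prop :=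
  abs_summable (fun x : S * G => flow act p c x * energy_density f x).

Definition two_flow (x : SGG) : R := p x.1 * (jump x.1 x.2.1 * jump x.1 x.2.2).

Lemma two_flow_ge0 x : 0 <= two_flow x.
Proof. by rewrite mulr_ge0 ?mulr_ge0 ?jump_rate_ge0// ltW. Qed.

(** The corner expression vanishes as soon as one of the two moves fixes the state. *)
Lemma rate2_corner f (x : SGG) :
  p x.1 * rate2 c x.1 x.2.1 x.2.2 * bochner_corner act f x =
  two_flow x * bochner_corner act f x.
Proof.
case: x => s [g d]; rewrite /two_flow /rate2 /bochner_corner /jump_rate /=.
have [->|_] := eqVneq (act g s) s; first by rewrite /corner /score !subrr !(mulr0, mul0r, addr0).
have [->|_] := eqVneq (act d s) s; first by rewrite /corner /score !subrr !(mulr0, mul0r, addr0).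
by rewrite !mulr1.
Qed.

Lemma energy_expect f : energy_finite f ->
  expect p (fun s => tsum (energy_term act c f (logf f) s)) = energy f.
Proof.
have E x := energy_flow act p c f (logf f) x.
rewrite /energy_finite -(funext E) => sE.
by rewrite (expect_tsum p_gt0)// (funext E).
Qed.

Lemma energy_density_ge0 f (x : S * G) : positive_fct f -> 0 <= energy_density f x.
Proof.
move=> f0; have [k k0] := ln_secant (f0 x.1) (f0 (act x.2 x.1)).
by rewrite /energy_density /grad /logf => ->; rewrite mulrCA mulr_ge0// -expr2 sqr_ge0.
Qed.

Lemma clamp_energy_density f (x : S * G) N : positive_fct f ->
  `|energy_density (truncate f N) x| <= `|energy_density f x|.
Proof.
move=> f0; rewrite /energy_density !normrM; apply: ler_pM => //.
  exact/clamp_dist/trunc_lohi.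
by rewrite /grad /logf; apply: clamp_dist_ln; rewrite ?trunc_lo ?trunc_lohi.
Qed.

(** Truncating decreases each summand and is eventually the identity at any two given
    states, so dominated convergence applies. *)
Lemma energy_truncate f : positive_fct f -> energy_finite f ->
  energy (truncate f N) @[N --> \oo] --> energy f.
Proof.
move=> f0 sE; apply: tsum_dominated ((abs_summable_abs _).2 sE) _ _ => [N x|x].
  by rewrite normrM [leRHS]normrM ler_wpM2l// clamp_energy_density.
have := truncate_near f0 (act x.2 x.1); apply: filterS2 (truncate_near f0 x.1) => N.
by rewrite /energy_density /grad /logf => -> ->.
Qed.

Lemma energy_finite_truncate f N : positive_fct f -> energy_finite f ->
  energy_finite (truncate f N).
Proof.
move=> f0; apply: abs_summable_le => x.
by rewrite normrM [leRHS]normrM ler_wpM2l// clamp_energy_density.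
Qed.

Lemma energy_truncate_le f N : positive_fct f -> energy_finite f ->
  energy (truncate f N) <= energy f.
Proof.
move=> f0 sE; apply: ler_tsum => //; first exact: energy_finite_truncate.
move=> x; apply: le_trans (ler_norm _) _; rewrite normrM.
apply: le_trans (ler_wpM2l _ (clamp_energy_density _ _ f0)) _ => //.
rewrite -normrM ger0_norm// mulr_ge0 ?energy_density_ge0//.
by rewrite mulr_ge0 ?jump_rate_ge0// ltW.
Qed.

Lemma bochner_truncate f : positive_fct f ->
  abs_summable (fun x => two_flow x * bochner_corner act f x) ->
  tsum (fun x => two_flow x * bochner_corner act (truncate f N) x) @[N --> \oo] -->
  tsum (fun x => two_flow x * bochner_corner act f x).
Proof.
move=> f0 sB; apply: tsum_dominated ((abs_summable_abs _).2 sB) _ _ => [N x|x].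
  by rewrite normrM [leRHS]normrM ler_wpM2l// clamp_corner ?trunc_lohi// trunc_lo.
have h1 := truncate_near f0 (act x.2.1 x.1); have h2 := truncate_near f0 (act x.2.2 x.1).
apply: filterS3 (truncate_near f0 x.1) h1 h2 => N.
by rewrite /bochner_corner => -> -> ->.
Qed.

(** Positivity makes both factors of [L f * L (log f)] and of [(L f)^2 / f] converge
    absolutely at each state, so that the double sum is the sum of two products. *)
Lemma bochner_expand f : positive_fct f ->
  abs_summable (fun x => two_flow x * bochner_corner act f x) ->
  expect p (fun s => generator act c f s * generator act c (logf f) s) +
  expect p (fun s => generator act c f s ^+ 2 / f s) =
  tsum (fun x => two_flow x * bochner_corner act f x).
Proof.
move=> f0 sB.
pose u s g := jump s g * grad act g f s.
pose v s d := jump s d * grad act d (logf f) s.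
have uv s d : exists2 k, 0 <= k & v s d = k * u s d.
  have [k k0 e] := ln_secant (f0 s) (f0 (act d s)); exists k => //.
  by rewrite /v /u /logf /grad e; ring.
pose z s d := v s d + u s d / f s.
have nz s d : `|z s d| = `|v s d| + `|u s d / f s|.
  have [k k0 e] := uv s d; have fi : 0 <= (f s)^-1 by rewrite invr_ge0 ltW.
  rewrite /z e [_ / f s]mulrC -mulrDl !normrM (ger0_norm k0) (ger0_norm fi).
  by rewrite ger0_norm ?addr_ge0// mulrDl.
have Bz x : two_flow x * bochner_corner act f x = p x.1 * (u x.1 x.2.1 * z x.1 x.2.2).
  rewrite /two_flow /bochner_corner /corner /score /z /u /v /grad /logf; field.
  exact: lt0r_neq0.
have suz : abs_summable (fun x : SGG => p x.1 * (u x.1 x.2.1 * z x.1 x.2.2)).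
  by rewrite -(funext Bz).
have hb (a b d d' : R) : `|d| <= `|d'| -> `|a * (b * d)| <= `|a * (b * d')|.
  by move=> h; rewrite !normrM !ler_wpM2l.
have suv : abs_summable (fun x : SGG => p x.1 * (u x.1 x.2.1 * v x.1 x.2.2)).
  by apply: abs_summable_le suz => x; apply: hb; rewrite nz lerDl.
have suu : abs_summable (fun x : SGG => p x.1 * (u x.1 x.2.1 * (u x.1 x.2.2 / f x.1))).
  by apply: abs_summable_le suz => x; apply: hb; rewrite nz lerDr.
have su s : abs_summable (u s).
  have sz := abs_summable_weighted p_gt0
    (F := fun s (y : G * G) => u s y.1 * (u s y.2 / f s)) s suu.
  have [[d ud]|u0] := pselect (exists d, u s d != 0).
    apply: (@abs_summable_factor _ _ _ (u s) (fun d => u s d / f s) d) => //.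
    by rewrite mulf_neq0// invr_neq0// lt0r_neq0.
  apply: (@abs_summable_eq _ _ _ (fun=> 0)); last exact: abs_summable0.
  by move=> d; apply/eqP/negP => /negP ud; apply: u0; exists d.
have sv s : abs_summable (v s).
  have sz := abs_summable_weighted p_gt0
    (F := fun s (y : G * G) => u s y.1 * v s y.2) s suv.
  have [[d ud]|u0] := pselect (exists d, u s d != 0).
    have inj : injective (fun e : G => (d, e)) by move=> ? ? [].
    have := abs_summableZ (u s d)^-1 (abs_summable_comp inj sz).
    by apply: abs_summable_eq => e /=; rewrite mulKf.
  apply: (@abs_summable_eq _ _ _ (fun=> 0)); last exact: abs_summable0.
  move=> d; have [k _ ->] := uv s d.
  suff -> : u s d = 0 by rewrite mulr0.
  by apply/eqP/negP => /negP ud; apply: u0; exists d.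
have genu s : generator act c f s = tsum (u s).
  by congr tsum; apply/funext => g; rewrite rate_grad.
have genv s : generator act c (logf f) s = tsum (v s).
  by congr tsum; apply/funext => g; rewrite rate_grad.
transitivity (tsum (fun x : SGG => p x.1 * (u x.1 x.2.1 * v x.1 x.2.2)) +
              tsum (fun x : SGG => p x.1 * (u x.1 x.2.1 * (u x.1 x.2.2 / f x.1)))); last first.
  rewrite -tsumD//; congr tsum; apply/funext => x; rewrite Bz /z; ring.
congr (_ + _).
  rewrite -(expect_tsum p_gt0 (F := fun s (y : G * G) => u s y.1 * v s y.2))//.
  congr (expect p _); apply/funext => s.
  by rewrite genu genv tsum_prod.
rewrite -(expect_tsum p_gt0 (F := fun s (y : G * G) => u s y.1 * (u s y.2 / f s)))//.
congr (expect p _); apply/funext => s.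
have suf : abs_summable (fun d => u s d / f s).
  by apply: (@abs_summable_eq _ _ _ (fun d => (f s)^-1 * u s d)) (abs_summableZ _ (su s)) => d;
     rewrite mulrC.
rewrite genu (tsum_prod (su s) suf) expr2 -mulrA; congr (_ * _).
by rewrite mulrC -tsumZ//; congr tsum; apply/funext => d; rewrite mulrC.
Qed.

Context (r_ge0 : forall s g d, 0 <= r s g d).
Context (r_inv : forall s g d, 0 < r s g d -> act (inv g) (act g s) = s).
Context (r_P1 : P1 r) (r_P2 : P2 act inv p r) (r_P3 : P3 act r).
Context (Gamma_defined : forall f : S -> R, bounded_pos f ->
    expect2_defined p (bochner_term act (Gamma c r) f)).
Context (Gamma_ge : forall f : S -> R, positive_fct f ->
    expect2_defined p (bochner_term act (Gamma c r) f) ->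
    abs_summable (fun x : S * G => p x.1 * energy_term act c f (logf f) x.1 x.2) ->
    kappa / 2 * expect p (fun s => tsum (energy_term act c f (logf f) s)) <=
    expect2 p (bochner_term act (Gamma c r) f)).

Let r_corner f (x : SGG) : R := p x.1 * r x.1 x.2.1 x.2.2 * bochner_corner act f x.

(** For [f] bounded away from 0 and infinity the corner expression is bounded, so the
    part carrying [r] converges, and with it the part carrying the rates. *)
Let r_summable f : bounded_pos f -> abs_summable (r_corner f).
Proof.
move=> [m [M [m0 fmM]]]; case: r_P2 => sq _.
by apply: (abs_summable_bounded sq) => x; exact: (corner_bound m0 (fmM _) (fmM _) (fmM _)).
Qed.

Let Gamma_corner f (x : SGG) :
  p x.1 * bochner_term act (Gamma c r) f x.1 x.2.1 x.2.2 =
  two_flow x * bochner_corner act f x - r_corner f x.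
Proof. by rewrite -rate2_corner bochner_termE /r_corner /Gamma; ring. Qed.

Lemma two_flow_corner_summable f : bounded_pos f ->
  abs_summable (fun x => two_flow x * bochner_corner act f x).
Proof.
move=> bf; have := abs_summableD (Gamma_defined bf) (r_summable bf).
by apply: abs_summable_eq => x; rewrite Gamma_corner subrK.
Qed.

Lemma bochner_bounded f : bounded_pos f -> energy_finite f ->
  kappa / 2 * energy f <= tsum (fun x => two_flow x * bochner_corner act f x).
Proof.
move=> bf sE; have sB := two_flow_corner_summable bf; have sr := r_summable bf.
have f0 : positive_fct f.
  by case: bf => m [M [m0 fmM]] s; have := fmM s; lra.
have := Gamma_ge f0 (Gamma_defined bf); rewrite energy_expect//.
rewrite (expect2E p_gt0 (Gamma_defined bf)) (funext (Gamma_corner f)) tsumB//.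
have : 0 <= tsum (r_corner f).
  by case: bf => m [M [m0 fmM]]; exact: (square_part_ge0 p_gt0 r_ge0 r_inv r_P1 r_P2 r_P3 m0 fmM).
move=> r0 H; suff /H : abs_summable
    (fun x : S * G => p x.1 * energy_term act c f (logf f) x.1 x.2) by lra.
by apply: abs_summable_eq sE => x; rewrite energy_flow.
Qed.

Lemma bochner_inequality f : positive_fct f -> energy_finite f ->
  abs_summable (fun x => two_flow x * bochner_corner act f x) ->
  kappa / 2 * energy f <= tsum (fun x => two_flow x * bochner_corner act f x).
Proof.
move=> f0 sE sB.
have cE : (kappa / 2 * energy (truncate f N)) @[N --> \oo] --> kappa / 2 * energy f.
  by apply: cvgM; [exact: cvg_cst|exact: energy_truncate].
have cB := bochner_truncate f0 sB.
apply: (ler_cvg_to cE cB); near=> N.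
apply: bochner_bounded; first exact: truncate_bounded.
exact: energy_finite_truncate.
Unshelve. all: by end_near.
Qed.

End bochner.

(** * Unfriendly colourings *)

Section unfriendly.
Context {R : realType}.

(** A colouring of maximal cut: recolouring a single vertex cannot increase the cut. *)
Lemma unfriendly_finite (T : finType) (W : T -> T -> R) :
  (forall x y, W x y = W y x) -> (forall x, W x x = 0) ->
  exists f : T -> bool,
    forall x, \sum_y W x y <= 2 * \sum_y W x y * (f y != f x)%:R.
Proof.
move=> Wsym W0.
pose cut (f : {ffun T -> bool}) : R := \sum_x \sum_y W x y * (f y != f x)%:R.
pose f := [arg max_(f > [ffun=> true] | true) cut f]%O.
have fmax h : cut h <= cut f.
  by rewrite /f; case: (@Order.TotalTheory.arg_maxP _ _ _ [ffun=> true] xpredT cut) => // i _; apply.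
exists f => x.
pose h := [ffun y => if y == x then ~~ f x else f y].
(* Only the edges at [x] change when [x] is recoloured; symmetry counts each twice. *)
have split (k : {ffun T -> bool}) : cut k =
    \sum_(y | y != x) \sum_(z | z != x) W y z * (k z != k y)%:R +
    2 * \sum_(y | y != x) W x y * (k y != k x)%:R.
  rewrite /cut (bigD1 x)//= (bigD1 x)//= W0 mul0r add0r.
  rewrite [X in _ + X](eq_bigr (fun y => W x y * (k y != k x)%:R +
      \sum_(z | z != x) W y z * (k z != k y)%:R)); last first.
    by move=> y yx; rewrite (bigD1 x)//= [W y x]Wsym [k x == _]eq_sym.
  by rewrite big_split/= mulr_natl mulr2n addrA addrC.
have := fmax h; rewrite !split.
rewrite [X in X + _ <= _](eq_bigr (fun y => \sum_(z | z != x) W y z * (f z != f y)%:R)); last first.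
  move=> y /negPf yx; apply: eq_bigr => z /negPf zx.
  by rewrite !ffunE yx zx.
rewrite lerD2l ler_pM2l//.
rewrite (eq_bigr (fun y => W x y - W x y * (f y != f x)%:R)); last first.
  move=> y /negPf yx; rewrite !ffunE yx eqxx.
  by case: (f y); case: (f x) => /=; lra.
rewrite sumrB => H.
by rewrite (bigD1 x)//= W0 add0r [X in _ <= _ * X](bigD1 x)//= W0 mul0r add0r; lra.
Qed.

Lemma unfriendly_seq (S : choiceType) (W : S -> S -> R) (B : seq S) : uniq B ->
  (forall x y, W x y = W y x) -> (forall x, W x x = 0) ->
  exists f : S -> bool, forall x, x \in B ->
    \sum_(y <- B) W x y <= 2 * \sum_(y <- B) W x y * (f y != f x)%:R.
Proof.
move=> uB Wsym W0; pose e i := tnth (in_tuple B) i.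
have [F Fi] := @unfriendly_finite 'I_(size B) (fun i j => W (e i) (e j))
  (fun _ _ => Wsym _ _) (fun _ => W0 _).
have einj : injective e by apply/tuple_uniqP.
exists (fun x => [exists i, (e i == x) && F i]).
have fE i : [exists j, (e j == e i) && F j] = F i.
  by apply/existsP/idP => [[j /andP[/eqP/einj->]]//|Fi']; exists i; rewrite eqxx.
move=> x /(tnthP (in_tuple B))[i ->].
rewrite (big_tnth _ _ B) [X in _ <= _ * X](big_tnth _ _ B).
under [X in _ * X]eq_bigr => j _ do rewrite -/(e j) -/(e i) !fE.
exact: Fi.
Qed.

Definition pickle_lt (S : countType) (n : nat) : seq S := pmap pickle_inv (iota 0 n).

Lemma pickle_lt_uniq (S : countType) n : uniq (pickle_lt S n).
Proof. by apply: pmap_uniq (iota_uniq _ _) => x; exact: pickle_invK. Qed.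

Lemma mem_pickle_lt (S : countType) n (x : S) : (pickle x < n)%N -> x \in pickle_lt S n.
Proof.
move=> xn; rewrite mem_pmap; apply/mapP; exists (pickle x).
  by rewrite mem_iota.
by rewrite pickleK_inv.
Qed.

(** The colourings of finite sets have a limit along an ultrafilter; the
    summability of the rows lets the inequality pass to the limit. *)
Lemma unfriendly (S : countType) (W : S -> S -> R) :
  (forall x y, 0 <= W x y) -> (forall x, abs_summable (W x)) ->
  (forall x y, W x y = W y x) -> (forall x, W x x = 0) ->
  exists f : S -> bool, forall x,
    tsum (W x) <= 2 * tsum (fun y => W x y * (f y != f x)%:R).
Proof.
move=> W_ge0 sW Wsym W0.
have /choice[F FP] := fun n => unfriendly_seq (pickle_lt_uniq S n) Wsym W0.
have [U [UU sU]] := ultraFilterLemma (F := \oo) _.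
have FU : Filter U by apply: filter_filter.
pose f x := `[< U [set n | F n x] >].
have Uf x : U [set n | F n x = f x].
  rewrite /f; have [Ux|Ux] := in_ultra_setVsetC [set n | F n x] UU.
    by rewrite (asboolT Ux); apply: filterS Ux => n /= ->.
  case: asboolP => [Ux'|_]; last by apply: filterS Ux => n /= /negP/negPf.
  by have := @filterI _ _ FU _ _ Ux' Ux; rewrite setICr => /(@filter_not_empty _ _ (ultra_proper)).
have Useq (D : seq S) : U [set n | forall y, y \in D -> F n y = f y /\ y \in pickle_lt S n].
  elim: D => [|x D IH]; first by apply: filterS filterT => n _ y; rewrite in_nil.
  have Ux : U [set n | x \in pickle_lt S n].
    by apply: sU; exists (pickle x).+1 => // n /= xn; exact: mem_pickle_lt.
  apply: filterS (filterI IH (filterI (Uf x) Ux)) => n [Dn [xn xn']] y.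
  by rewrite inE => /orP[/eqP->//|/Dn].
exists f => x; apply/ler_addgt0Pr => e e0.
have e4 : 0 < e / 4 by rewrite divr_gt0.
have [D [uD /ltW hD tD]] := tsum_tail (W_ge0 x) (sW x) e4.
have [n Dn] := filter_ex (Useq (x :: D)).
have sub (P : pred S) := abs_summable_mask P (sW x).
set T := tsum (fun y => W x y * _).
set B := pickle_lt S n; have uB : uniq B by exact: pickle_lt_uniq.
have [Fx xB] := Dn x (mem_head _ _).
have : \sum_(y <- B) W x y * (F n y != F n x)%:R <= T + e / 4.
  apply: le_trans (lerD (lexx T) tD); rewrite -tsumD//.
  apply: le_trans (tsum_finite_le _ _ uB); last 2 first.
  - by move=> t; rewrite addr_ge0// mulr_ge0.
  - exact: abs_summableD.
  apply: ler_sum => y _; rewrite Fx -mulrDr ler_wpM2l//.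
  have [yD|yD] /= := boolP (y \in D); last by case: (_ != _) (_ != _) => -[] /=; lra.
  by rewrite addr0 (Dn y _).1 ?inE ?yD ?orbT.
have : tsum (W x) - e / 4 <= \sum_(y <- B) W x y.
  apply: le_trans hD _.
  have pD : perm_eq [seq y <- B | y \in D] D.
    apply: uniq_perm => // [|y]; first exact: filter_uniq.
    rewrite mem_filter; case: (boolP (y \in D)) => //= yD.
    by have [] := Dn y; rewrite ?inE ?yD ?orbT.
  rewrite -(perm_big _ pD) big_filter big_mkcond /=.
  by apply: ler_sum => y _; case: ifP.
by have := FP n x xB; rewrite -/B; lra.
Qed.

End unfriendly.

(** * The second moment of the exit rates *)

Section second_moment.
Context {R : realType} {S G : countType} (act : G -> S -> S) (inv : G -> G).
Context (p : S -> R) (c : S -> G -> R).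
Context (p_prob : is_prob p) (p_gt0 : forall s, 0 < p s).
Context (c_ge0 : forall s g, 0 <= c s g) (c_rev : reversible act inv p c).
Context (corner_summable : forall f : S -> R, bounded_pos f ->
  abs_summable (fun x => two_flow act p c x * bochner_corner act f x)).

Local Notation jump := (jump_rate act c).
Local Notation SGG := (S * (G * G))%type.

Let jump_ge0 s g : 0 <= jump s g. Proof. exact: jump_rate_ge0. Qed.

Let cut (P : S -> bool) s g : R := jump s g * (P (act g s) != P s)%:R.

Let cut_ge0 P s g : 0 <= cut P s g. Proof. exact: mulr_ge0. Qed.

(** The function 1 + P takes the values 1 and 2, so that the corner expression is at
    least 1/2 in absolute value when both moves change the colour. *)
Let cut_summable (P : S -> bool) :
  abs_summable (fun x : SGG => p x.1 * (cut P x.1 x.2.1 * cut P x.1 x.2.2)).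
Proof.
pose f s : R := 1 + (P s)%:R.
have fb s : 1 <= f s <= 2.
  by rewrite /f; case: (P s) => /=; apply/andP; split; lra.
have bf : bounded_pos f by exists 1, 2.
have := abs_summableZ 2 (corner_summable bf); apply: abs_summable_le => -[s [g d]] /=.
have f0 t : 0 < f t by have := fb t; lra.
pose w := p s * (jump s g * jump s d).
have w0 : 0 <= w by rewrite /w mulr_ge0 ?mulr_ge0// ltW.
rewrite ger0_norm; last by rewrite mulr_ge0 ?mulr_ge0 ?cut_ge0// ltW.
rewrite [leRHS]normrM [`|2|]ger0_norm//.
have -> : p s * (cut P s g * cut P s d) =
    w * ((P (act g s) != P s)%:R * (P (act d s) != P s)%:R).
  by rewrite /w /cut; ring.
rewrite normrM [`|two_flow _ _ _ _|]ger0_norm ?two_flow_ge0//.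
rewrite /two_flow /= -/w [leRHS]mulrCA ler_wpM2l// /bochner_corner norm_corner//= [leRHS]mulrCA.
apply: ler_pM => //.
  by rewrite /f; case: (P _); case: (P _) => /=;
     rewrite ler_normr; apply/orP; (left; lra) || (right; lra).
apply: (@le_trans _ _ (2 * `|(f (act d s) - f s) / f s|)); last first.
  by rewrite ler_wpM2l// lerDr.
rewrite normrM normfV (gtr0_norm (f0 s)) mulrA ler_pdivlMr//.
have := fb s => /andP[_ fs2].
apply: (@le_trans _ _ ((P (act d s) != P s)%:R * 2)); first by rewrite ler_wpM2l.
rewrite mulrC ler_wpM2l//.
by rewrite /f; case: (P _); case: (P _) => /=;
   rewrite ler_normr; apply/orP; (left; lra) || (right; lra).
Qed.

(** Colouring a single state separates it from the targets of all its jumps. *)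
Lemma jump_summable s : abs_summable (jump s).
Proof.
have := abs_summable_weighted p_gt0
  (F := fun t (y : G * G) => cut (pred1 s) t y.1 * cut (pred1 s) t y.2) s
  (cut_summable (pred1 s)).
have E g : cut (pred1 s) s g = jump s g.
  rewrite /cut /= eqxx /jump_rate; by case: (eqVneq (act g s) s) => /=; rewrite !(mulr0, mul0r, mulr1).
under eq_fun do rewrite !E.
have [[d ud]|u0] := pselect (exists d, jump s d != 0).
  exact: (@abs_summable_factor _ _ _ (jump s) (jump s) d).
move=> _; apply: (@abs_summable_eq _ _ _ (fun=> 0)); last exact: abs_summable0.
by move=> d; apply/eqP/negP => /negP ud; apply: u0; exists d.
Qed.

Definition exit_rate s : R := tsum (jump s).

Lemma exit_rate_ge0 s : 0 <= exit_rate s.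
Proof. by apply: tsum_ge0 => //; exact: jump_summable. Qed.

Let target s y : R := tsum (fun g => jump s g * (act g s == y)%:R).

Let target_summable s y : abs_summable (fun g => jump s g * (act g s == y)%:R).
Proof. exact: (abs_summable_mask (fun g => act g s == y) (jump_summable s)). Qed.

Let tsum_target s (P : pred S) :
  abs_summable (fun y => target s y * (P y)%:R) /\
  tsum (fun y => target s y * (P y)%:R) = tsum (fun g => jump s g * (P (act g s))%:R).
Proof.
pose F (x : G * S) := jump s x.1 * (act x.1 s == x.2)%:R * (P x.2)%:R.
have F0 x : 0 <= F x by rewrite !mulr_ge0.
have single g y : y != act g s -> F (g, y) = 0.
  by rewrite /F /= eq_sym => /negPf ->; rewrite mulr0 mul0r.
have rowE g : tsum (fun y => F (g, y)) = jump s g * (P (act g s))%:R.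
  by rewrite (tsum_single (single g)).2 /F /= eqxx mulr1.
have sF : abs_summable F.
  apply: abs_summable_pair => [g|]; first exact: (tsum_single (single g)).1.
  apply: abs_summable_le (jump_summable s) => g.
  rewrite (_ : (fun b => `|F (g, b)|) = fun b => F (g, b)); last first.
    by apply/funext => y; rewrite ger0_norm.
  rewrite rowE normrM ler_piMr//.
  by case: (P _); rewrite ?normr0 ?normr1.
have colE y : tsum (fun g => F (g, y)) = target s y * (P y)%:R.
  rewrite /target mulrC -tsumZ; last exact: target_summable.
  by congr tsum; apply/funext => g; rewrite mulrC.
split.
  pose e (x : S * G) := (x.2, x.1).
  have be : injective e by move=> [? ?] [? ?] [-> ->].
  have := abs_summable_tsum (abs_summable_comp be sF).
  by apply: abs_summable_eq => y; rewrite -colE.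
by rewrite -(funext colE) tsum_exchange// (funext rowE).
Qed.

(** The assumption bounds, for a two-valued function, only the rates of moves that
    change its value; for an unfriendly colouring these are at least half of all
    rates, at every state. Reversibility makes the jump weights symmetric, as the
    existence of such a colouring requires. *)
Lemma exit_rate_sqr_summable : abs_summable (fun s => p s * exit_rate s ^+ 2).
Proof.
pose W s y := p s * (target s y * (y != s)%:R).
have W0 s y : 0 <= W s y.
  apply: mulr_ge0; first exact: ltW.
  by apply: mulr_ge0 => //; apply: tsum_ge0 => // g; rewrite mulr_ge0.
have sW s : abs_summable (W s) by apply: abs_summableZ (tsum_target s (predC1 s)).1.
have Wxx s : W s s = 0 by rewrite /W eqxx !mulr0.
have invK : involutive inv by case: c_rev.
have Wsym s y : W s y = W y s.
  suff h : p s * target s y = p y * target y s.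
    by rewrite /W !mulrA h [y == s]eq_sym.
  rewrite /target -!tsumZ//.
  rewrite -[RHS](tsum_bij _ (Bijective invK invK)); congr tsum; apply/funext => g /=.
  (* Each move from [s] to [y] is paired with its inverse; the hypothesis of positive
     weight on one side is what makes the inverse move return. *)
  have half s' y' g' : p s' * (jump s' g' * (act g' s' == y')%:R) != 0 ->
      p s' * (jump s' g' * (act g' s' == y')%:R) =
      p y' * (jump y' (inv g') * (act (inv g') y' == s')%:R).
    have [<-|_] := eqVneq (act g' s') y'; last by rewrite !mulr0 eqxx.
    rewrite mulr1 => f0; have [/= E Ef] := flow_rev c_ge0 c_rev (x := (s', g')) f0.
    by move: E Ef; rewrite /rev_edge /flow /= => -[E _] Ef; rewrite E eqxx mulr1 Ef.
  have [l0|/half//] := eqVneq (p s * (jump s g * (act g s == y)%:R)) 0.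
  have [->//|/half] := eqVneq (p y * (jump y (inv g) * (act (inv g) y == s)%:R)) 0.
  by rewrite invK => ->.
have [P hP] := unfriendly W0 sW Wsym Wxx.
have scut s : abs_summable (cut P s).
  exact: (abs_summable_mask (fun g => P (act g s) != P s) (jump_summable s)).
have hC s : exit_rate s <= 2 * tsum (cut P s).
  have := hP s; rewrite /W tsumZ; last exact: (tsum_target s (predC1 s)).1.
  rewrite (tsum_target s (predC1 s)).2 /=.
  have -> : tsum (fun g => jump s g * (act g s != s)%:R) = exit_rate s.
    congr tsum; apply/funext => g; rewrite /jump_rate.
    by case: (act g s == s); rewrite /= ?mulr0 ?mulr1.
  have -> : (fun y => p s * (target s y * (y != s)%:R) * (P y != P s)%:R) =
            (fun y => p s * (target s y * (P y != P s)%:R)).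
    apply/funext => y; have [->|_] := eqVneq y s; first by rewrite eqxx !mulr0.
    by rewrite /= mulr1 mulrA.
  rewrite tsumZ; last exact: (tsum_target s (fun y => P y != P s)).1.
  rewrite (tsum_target s (fun y => P y != P s)).2 mulrCA ler_pM2l//.
have := abs_summableZ 4 (abs_summable_expect p_gt0
  (F := fun s (y : G * G) => cut P s y.1 * cut P s y.2) (cut_summable P)).
apply: abs_summable_le => s; rewrite tsum_prod//.
have C0 := exit_rate_ge0 s; have T0 : 0 <= tsum (cut P s) by exact: tsum_ge0.
have A0 : 0 <= p s * exit_rate s ^+ 2 by rewrite mulr_ge0 ?sqr_ge0// ltW.
have B0 : 0 <= 4 * (p s * (tsum (cut P s) * tsum (cut P s))).
  by rewrite mulr_ge0// mulr_ge0 ?mulr_ge0// ltW.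
rewrite (ger0_norm A0) (ger0_norm B0) [leRHS]mulrCA ler_pM2l// expr2.
by have := ler_pM C0 C0 (hC s) (hC s); lra.
Qed.

Lemma two_flow_summable : abs_summable (two_flow act p c).
Proof.
apply: abs_summable_pair => [s|].
  have sj := jump_summable s.
  exact: (abs_summableZ (p s) (abs_summable_prod sj sj)).
apply: abs_summable_eq exit_rate_sqr_summable => s.
rewrite (_ : (fun b => _) = fun y : G * G => p s * (jump s y.1 * jump s y.2)); last first.
  by apply/funext => y; rewrite ger0_norm ?two_flow_ge0.
have sj := jump_summable s.
by rewrite tsumZ ?tsum_prod ?expr2//; exact: abs_summable_prod.
Qed.

Lemma flow_summable : abs_summable (flow act p c).
Proof.
apply: abs_summable_pair => [s|]; first exact: (abs_summableZ (p s) (jump_summable s)).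
have := abs_summableD (p_summable p_prob) exit_rate_sqr_summable.
apply: abs_summable_le => s.
rewrite (_ : (fun b => _) = fun g => p s * jump s g); last first.
  by apply/funext => g; rewrite ger0_norm ?mulr_ge0 ?(ltW (p_gt0 s)).
rewrite tsumZ; last exact: jump_summable.
have C0 := exit_rate_ge0 s; have ps := ltW (p_gt0 s).
rewrite -/(exit_rate s) !ger0_norm ?addr_ge0 ?mulr_ge0 ?sqr_ge0//.
by rewrite -{2}[p s]mulr1 -mulrDr ler_wpM2l// expr2; nra.
Qed.

End second_moment.

(** * Convexity and Taylor bounds *)

Section entropy_production.
Context {R : realType}.
Implicit Types a b u v m M : R.

(** Convexity of x ln x; for [x] a comparison density and [y] a function it is also
    Gibbs' inequality. *)
Lemma entropy_tangent x y : 0 < x -> 0 < y ->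
  (y * ln y) >= x * ln x + (y - x) * (ln x + 1) :> R.
Proof.
move=> x0 y0; have xy : 0 < x / y by rewrite divr_gt0.
have := ln_le_sub1 xy; rewrite ln_div ?posrE// => h.
have : y * (ln x - ln y) <= y * (x / y - 1) by rewrite ler_wpM2l// ltW.
have -> : y * (x / y - 1) = x - y by field; exact: lt0r_neq0.
by lra.
Qed.

(** The terms with ln a' in the entropy production. Both estimates come from
    ln x <= x - 1, applied to a'/a and to a/a'; the remainders are quadratic in the
    increments, with constants depending on the band only. *)
Let half_taylor m M a b a' b' : 0 < m -> m <= a <= M -> m <= b <= M ->
  m <= a' <= M -> m <= b' <= M ->
  (a' - b') * ln a' <= (a' - b') * ln a + (a' - a) - (a' - a) * b / a +
    ((a' - a) ^+ 2 + (b' - b) ^+ 2) * (m^-1 + m^-1 / 2 + M / m ^+ 2).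
Proof.
move=> m0 /andP[ma aM] /andP[mb bM] /andP[ma' a'M] /andP[mb' b'M].
have a0 : 0 < a by lra. have b0 : 0 < b by lra.
have a'0 : 0 < a' by lra. have b'0 : 0 < b' by lra.
have M0 : 0 < M by lra.
set u := a' - a; set v := b' - b.
have h1 : a' * ln a' <= a' * ln a + (u + u ^+ 2 / a).
  have h : 0 < a' / a by rewrite divr_gt0.
  have := ln_le_sub1 h; rewrite ln_div ?posrE// => l.
  have : a' * (ln a' - ln a) <= a' * (a' / a - 1) by rewrite ler_wpM2l// ltW.
  have -> : a' * (a' / a - 1) = u + u ^+ 2 / a by rewrite /u; field; exact: lt0r_neq0.
  by lra.
have h2 : - (b' * ln a') <= - (b' * ln a) +
    (- (u * b / a) - u * v / a' + b * u ^+ 2 / (a * a')).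
  have h : 0 < a / a' by rewrite divr_gt0.
  have := ln_le_sub1 h; rewrite ln_div ?posrE// => l.
  have : b' * (ln a - ln a') <= b' * (a / a' - 1) by rewrite ler_wpM2l// ltW.
  have -> : b' * (a / a' - 1) = - (u * b / a) - u * v / a' + b * u ^+ 2 / (a * a').
    by rewrite /u /v; field; rewrite !lt0r_neq0.
  by lra.
have u2 : 0 <= u ^+ 2 by exact: sqr_ge0.
have v2 : 0 <= v ^+ 2 by exact: sqr_ge0.
have mi x : m <= x -> x^-1 <= m^-1.
  by move=> mx; rewrite lef_pV2 ?posrE//; exact: lt_le_trans mx.
have h3 : u ^+ 2 / a <= u ^+ 2 / m by rewrite ler_wpM2l ?mi.
have h4 : - (u * v / a') <= (u ^+ 2 + v ^+ 2) / 2 / m.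
  apply: (@le_trans _ _ ((u ^+ 2 + v ^+ 2) / 2 / a')).
    rewrite -mulNr ler_wpM2r ?invr_ge0 ?(ltW a'0)//.
    by have := sqr_ge0 (u + v); rewrite !expr2; lra.
  by rewrite ler_wpM2l ?mi// divr_ge0// addr_ge0.
have h5 : b * u ^+ 2 / (a * a') <= M * u ^+ 2 / m ^+ 2.
  apply: ler_pM.
  - by rewrite mulr_ge0// ltW.
  - by rewrite invr_ge0 mulr_ge0 ?ltW.
  - by rewrite ler_wpM2r.
  - by rewrite lef_pV2 ?posrE ?exprn_gt0 ?mulr_gt0// expr2 ler_pM// ltW.
have h6 : 0 <= v ^+ 2 / m by rewrite divr_ge0// ltW.
have h7 : 0 <= v ^+ 2 * (M / m ^+ 2) by rewrite mulr_ge0// divr_ge0 ?exprn_ge0 ?ltW.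
rewrite mulrBl [(_ - b') * ln a]mulrBl.
by lra.
Qed.

Lemma entropy_production_taylor m M a b a' b' : 0 < m ->
  m <= a <= M -> m <= b <= M -> m <= a' <= M -> m <= b' <= M ->
  (b' - a') * (ln b' - ln a') <= (b - a) * (ln b - ln a)
    - (a' - a) * score a b - (b' - b) * score b a +
    ((a' - a) ^+ 2 + (b' - b) ^+ 2) * (3 / m + 2 * M / m ^+ 2).
Proof.
move=> m0 ha hb ha' hb'.
have h1 := half_taylor m0 ha hb ha' hb'; have h2 := half_taylor m0 hb ha hb' ha'.
have a0 : a != 0 by apply: lt0r_neq0; case/andP: ha => h _; exact: lt_le_trans h.
have b0 : b != 0 by apply: lt0r_neq0; case/andP: hb => h _; exact: lt_le_trans h.
have E1 : (a' - a) * score a b = (a' - a) * (ln b - ln a) + (a' - a) * b / a - (a' - a).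
  by rewrite /score; field.
have E2 : (b' - b) * score b a = (b' - b) * (ln a - ln b) + (b' - b) * a / b - (b' - b).
  by rewrite /score; field.
rewrite E1 E2; lra.
Qed.

End entropy_production.

(** * Euler steps of the truncated evolution *)

Section flow_step.
Context {R : realType} {S G : countType} (act : G -> S -> S) (inv : G -> G).
Context (p : S -> R) (c : S -> G -> R).
Context (p_prob : is_prob p) (p_gt0 : forall s, 0 < p s).
Context (c_ge0 : forall s g, 0 <= c s g) (c_rev : reversible act inv p c).
Context (jump_summable : forall s, abs_summable (jump_rate act c s)).
Context (flow_summable : abs_summable (flow act p c)).
Context (two_flow_summable : abs_summable (two_flow act p c)).
Context (m M : R) (m_gt0 : 0 < m).

Local Notation jump := (jump_rate act c).
Local Notation SGG := (S * (G * G))%type.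
Implicit Types (f h : S -> R) (n : nat).

Definition in_band f : Prop := forall s, m <= f s <= M.

Definition slow n s : bool := exit_rate act c s <= n%:R.

(** Moves between two states of exit rate at most [n]. The condition is symmetric in
    the two states, so that the truncated generator is still reversible. *)
Definition cutoff n s g : R := (slow n s && slow n (act g s))%:R.

Definition drift n f s : R := tsum (fun g => jump s g * cutoff n s g * grad act g f s).

Let jump_ge0 s g : 0 <= jump s g. Proof. exact: jump_rate_ge0. Qed.

Let cutoff_ge0 n s g : 0 <= cutoff n s g. Proof. exact: ler0n. Qed.

Let cutoff_le1 n s g : cutoff n s g <= 1. Proof. by rewrite /cutoff lern1 leq_b1. Qed.

Let cutoff_norm n s g : `|cutoff n s g| <= 1.
Proof. by rewrite ger0_norm. Qed.

Let mM f (s : S) : in_band f -> m <= M.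
Proof. by move=> /(_ s)/andP[]; exact: le_trans. Qed.

Let grad_norm f s g : in_band f -> `|grad act g f s| <= M - m.
Proof.
move=> bf; have := bf s; have := bf (act g s); rewrite /grad => /andP[? ?] /andP[? ?].
by rewrite ler_norml; apply/andP; split; lra.
Qed.

Let row_summable n s : abs_summable (fun g => jump s g * cutoff n s g).
Proof. exact: abs_summable_bounded (jump_summable s) (cutoff_norm n s). Qed.

Let drift_summable n f s : in_band f ->
  abs_summable (fun g => jump s g * cutoff n s g * grad act g f s).
Proof.
by move=> bf; apply: (abs_summable_bounded (row_summable n s)) => g; exact: grad_norm.
Qed.

Let row_le n s : tsum (fun g => jump s g * cutoff n s g) <= n%:R.
Proof.
have [sn|sn] := boolP (slow n s).
  apply: le_trans sn; apply: ler_tsum => // g.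
  by rewrite -[leRHS]mulr1 ler_wpM2l.
rewrite (_ : (fun _ => _) = fun=> 0) ?tsum0//.
by apply/funext => g; rewrite /cutoff (negPf sn) mulr0.
Qed.

Lemma drift_itv n f s : in_band f ->
  - ((f s - m) * n%:R) <= drift n f s <= (M - f s) * n%:R.
Proof.
move=> bf; have /andP[mf fM] := bf s; have sd := drift_summable n s bf.
have sr := row_summable n s; have rl := row_le n s.
have w0 g : 0 <= jump s g * cutoff n s g by rewrite mulr_ge0.
apply/andP; split.
  apply: (@le_trans _ _ (tsum (fun g => (m - f s) * (jump s g * cutoff n s g)))).
    have fm : 0 <= f s - m by rewrite subr_ge0.
    by rewrite tsumZ//; have := ler_wpM2l fm rl; lra.
  apply: ler_tsum => //; first exact: abs_summableZ.
  move=> g; rewrite mulrC ler_wpM2l// /grad lerD2r.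
  by case/andP: (bf (act g s)).
apply: (@le_trans _ _ (tsum (fun g => (M - f s) * (jump s g * cutoff n s g)))).
  apply: ler_tsum => //; first exact: abs_summableZ.
  move=> g; rewrite [leRHS]mulrC ler_wpM2l// /grad lerD2r.
  by case/andP: (bf (act g s)).
by rewrite tsumZ// ler_wpM2l// subr_ge0.
Qed.

Lemma drift_norm n f s : in_band f -> `|drift n f s| <= (M - m) * n%:R.
Proof.
move=> bf; have /andP[h1 h2] := drift_itv n s bf; have /andP[mf fM] := bf s.
have n0 : 0 <= n%:R :> R by exact: ler0n.
have k1 : (f s - m) * n%:R <= (M - m) * n%:R by rewrite ler_wpM2r// lerD2r.
have k2 : (M - f s) * n%:R <= (M - m) * n%:R by rewrite ler_wpM2r// lerD2l lerN2.
by rewrite ler_norml; apply/andP; split; lra.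
Qed.

(** An explicit Euler step averages values of [f], provided that its length times
    the total truncated rate is at most 1. *)
Lemma step_in_band n f t : in_band f -> 0 <= t -> t * n%:R <= 1 ->
  in_band (fun s => f s + t * drift n f s).
Proof.
move=> bf t0 tn s; have /andP[h1 h2] := drift_itv n s bf; have /andP[mf fM] := bf s.
have k1 := ler_wpM2l t0 h1; have k2 := ler_wpM2l t0 h2.
have l1 : t * n%:R * (f s - m) <= 1 * (f s - m) by rewrite ler_wpM2r// subr_ge0.
have l2 : t * n%:R * (M - f s) <= 1 * (M - f s) by rewrite ler_wpM2r// subr_ge0.
by apply/andP; split; lra.
Qed.

Let cut_flow n (x : S * G) : R := flow act p c x * cutoff n x.1 x.2.

Let cut_flow_summable n : abs_summable (cut_flow n).
Proof. by apply: (abs_summable_bounded flow_summable) => x; exact: cutoff_norm. Qed.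

Let cut_flow_rev n x : cut_flow n x != 0 ->
  rev_edge act inv (rev_edge act inv x) = x /\
  cut_flow n (rev_edge act inv x) = cut_flow n x.
Proof.
rewrite /cut_flow mulf_eq0 negb_or => /andP[/(flow_rev c_ge0 c_rev)[E Ef] _].
split=> //; rewrite Ef; congr (_ * _); move: E; case: x {Ef} => s g.
by rewrite /rev_edge /cutoff /= => -[-> _]; rewrite andbC.
Qed.

Let expect_drift n f h (K : R) : in_band f -> (forall s, `|h s| <= K) ->
  abs_summable (fun x : S * G => cut_flow n x * (h x.1 * grad act x.2 f x.1)) /\
  expect p (fun s => h s * drift n f s) =
  tsum (fun x : S * G => cut_flow n x * (h x.1 * grad act x.2 f x.1)).
Proof.
move=> bf hK.
have s1 : abs_summable (fun x : S * G => cut_flow n x * (h x.1 * grad act x.2 f x.1)).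
  apply: (@abs_summable_bounded _ _ _ _ (K * (M - m)) (cut_flow_summable n)) => x.
  by rewrite normrM ler_pM// grad_norm.
split=> //.
have E (x : S * G) : p x.1 * (h x.1 * (jump x.1 x.2 * cutoff n x.1 x.2 * grad act x.2 f x.1)) =
    cut_flow n x * (h x.1 * grad act x.2 f x.1).
  by rewrite /cut_flow /flow; ring.
rewrite -(funext E).
rewrite -(expect_tsum p_gt0
  (F := fun s g => h s * (jump s g * cutoff n s g * grad act g f s))); last first.
  by rewrite (funext E).
congr tsum; apply/funext => s; congr (_ * _).
by rewrite /drift -tsumZ//; exact: drift_summable.
Qed.

Lemma expect_drift0 n f : in_band f -> expect p (drift n f) = 0.
Proof.
move=> bf; have h1 (s : S) : `|1 : R| <= 1 by rewrite normr1.
have [s1 E] := expect_drift n (h := fun=> 1) bf h1.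
transitivity (expect p (fun s => 1 * drift n f s)).
  by congr expect; apply/funext => s; rewrite mul1r.
rewrite E (sum_by_parts (f := fun=> 1) (@cut_flow_rev n) s1).2.
rewrite (_ : (fun _ => _) = fun=> 0) ?tsum0 ?mulr0 ?oppr0//.
by apply/funext => x; rewrite {1}/grad subrr mul0r mulr0.
Qed.

Lemma ln_band_norm f s : in_band f -> `|ln (f s)| <= `|ln m| + `|ln M|.
Proof.
move=> /(_ s)/andP[mf fM]; have hM := ler_norm (ln M).
have hm : - ln m <= `|ln m| by rewrite -normrN ler_norm.
have f0 : 0 < f s by exact: lt_le_trans mf.
have l1 : ln m <= ln (f s) by rewrite ler_ln ?posrE.
have l2 : ln (f s) <= ln M by rewrite ler_ln ?posrE//; exact: lt_le_trans fM.
have n1 := normr_ge0 (ln m); have n2 := normr_ge0 (ln M).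
by rewrite ler_norml; apply/andP; split; lra.
Qed.

Lemma band_gt0 f : in_band f -> positive_fct f.
Proof. by move=> bf s; case/andP: (bf s) => + _; exact: lt_le_trans. Qed.

Let flow_ge0 x : 0 <= flow act p c x.
Proof. by apply: flow_ge0. Qed.

Let energy_density_norm f x : in_band f ->
  `|energy_density act f x| <= (M - m) * ((`|ln m| + `|ln M|) + (`|ln m| + `|ln M|)).
Proof.
move=> bf; rewrite /energy_density normrM ler_pM ?grad_norm//.
by apply: le_trans (ler_normB _ _) _; apply: lerD; exact: ln_band_norm.
Qed.

Lemma band_energy_finite f : in_band f -> energy_finite act p c f.
Proof.
move=> bf; apply: (abs_summable_bounded flow_summable) => x.
exact: energy_density_norm.
Qed.

Lemma band_energy_ge0 f : in_band f -> 0 <= energy act p c f.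
Proof.
move=> bf; apply: tsum_ge0; last exact: band_energy_finite.
by move=> x; rewrite mulr_ge0 ?energy_density_ge0//; exact: band_gt0.
Qed.

(** The truncated energy is at most the full one, since its density is non-negative. *)
Let expect_drift_ln n f : in_band f ->
  - (2^-1 * energy act p c f) <= expect p (fun s => ln (f s) * drift n f s).
Proof.
move=> bf; have [s1 ->] := expect_drift n bf (fun s => ln_band_norm s bf).
have [s2 ->] := sum_by_parts (f := fun s => ln (f s)) (@cut_flow_rev n) s1.
rewrite lerN2 ler_wpM2l ?invr_ge0//; apply: ler_tsum => //; first exact: band_energy_finite.
move=> x; rewrite /cut_flow -mulrA ler_wpM2l//.
have ed := energy_density_ge0 act x (band_gt0 bf).
by rewrite mulrC [_ * grad act x.2 f x.1]mulrC -[leRHS]mulr1 ler_wpM2l.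
Qed.

Definition entropy f : R := expect p (fun s => f s * ln (f s)).

Lemma band_entropy_summable f : in_band f -> abs_summable (fun s => p s * (f s * ln (f s))).
Proof.
move=> bf; apply: (@p_mul_summable _ _ _ p_prob _ (M * (`|ln m| + `|ln M|))) => s.
rewrite normrM ler_pM ?ln_band_norm// gtr0_norm ?band_gt0//.
by case/andP: (bf s).
Qed.

(** Convexity of x ln x makes this exact: no second-order error. *)
Lemma entropy_step n f t : in_band f -> 0 <= t -> t * n%:R <= 1 ->
  entropy f - t * (2^-1 * energy act p c f) <= entropy (fun s => f s + t * drift n f s).
Proof.
move=> bf t0 tn; have bf' := step_in_band bf t0 tn.
have sd : abs_summable (fun s => p s * drift n f s).
  by apply: (p_mul_summable p_prob) => s; exact: drift_norm.
have sl : abs_summable (fun s => p s * (ln (f s) * drift n f s)).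
  apply: (@p_mul_summable _ _ _ p_prob _ ((`|ln m| + `|ln M|) * ((M - m) * n%:R))) => s.
  by rewrite normrM ler_pM ?ln_band_norm ?drift_norm.
have se := band_entropy_summable bf.
have sT := abs_summableD se
  (abs_summableD (abs_summableZ t sl) (abs_summableZ t sd)).
apply: (@le_trans _ _ (tsum (fun s => p s * (f s * ln (f s)) +
    (t * (p s * (ln (f s) * drift n f s)) + t * (p s * drift n f s))))); last first.
  apply: ler_tsum => //; first exact: band_entropy_summable.
  move=> s; have := entropy_tangent (band_gt0 bf s) (band_gt0 bf' s) => h.
  have := ler_wpM2l (ltW (p_gt0 s)) h; lra.
rewrite tsumD//; last by apply: abs_summableD; exact: abs_summableZ.
rewrite tsumD ?tsumZ//; try exact: abs_summableZ.
have := expect_drift0 n bf; rewrite /expect => ->; rewrite mulr0 addr0.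
by rewrite lerD2l -mulrN ler_wpM2l//; exact: expect_drift_ln.
Qed.

Definition cut_bochner n f : R :=
  tsum (fun x : SGG => two_flow act p c x * (cutoff n x.1 x.2.1 * bochner_corner act f x)).

(** The first-order change of the energy density along the drift, at the source of an
    edge; its value on the reversed edge is the change at the target. *)
Let tilt n f (x : S * G) : R := drift n f x.1 * score (f x.1) (f (act x.2 x.1)).

Let tilt_summable n f : in_band f -> abs_summable (fun x => flow act p c x * tilt n f x).
Proof.
move=> bf; apply: (@abs_summable_bounded _ _ _ _
  ((M - m) * n%:R * (`|ln m| + `|ln M| + M / m)) flow_summable) => x.
by rewrite normrM ler_pM ?drift_norm// (score_bound m_gt0 (bf _) (bf _)).
Qed.

Let tilt_bochner n f : in_band f ->
  tsum (fun x => flow act p c x * tilt n f x) = cut_bochner n f.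
Proof.
move=> bf.
pose u s g := jump s g * cutoff n s g * grad act g f s.
pose v s g := jump s g * score (f s) (f (act g s)).
have sv s : abs_summable (v s).
  by apply: (abs_summable_bounded (jump_summable s)) => g; exact: (score_bound m_gt0 (bf _) (bf _)).
have su s : abs_summable (u s) by exact: drift_summable.
have E1 (x : S * G) : flow act p c x * tilt n f x = p x.1 * (drift n f x.1 * v x.1 x.2).
  by rewrite /flow /tilt /v; ring.
have E2 (x : SGG) : two_flow act p c x * (cutoff n x.1 x.2.1 * bochner_corner act f x) =
    p x.1 * (u x.1 x.2.1 * v x.1 x.2.2).
  by rewrite /two_flow /bochner_corner /corner /u /v /grad; ring.
rewrite /cut_bochner (funext E1) (funext E2).
rewrite -(expect_tsum p_gt0 (F := fun s g => drift n f s * v s g)); last first.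
  by rewrite -(funext E1); exact: tilt_summable.
rewrite -(expect_tsum p_gt0 (F := fun s (y : G * G) => u s y.1 * v s y.2)); last first.
  rewrite -(funext E2).
  apply: (@abs_summable_bounded _ _ _ _
    (1 * (M * (`|ln m| + `|ln M| + M / m))) two_flow_summable) => x.
  by rewrite normrM ler_pM// (corner_bound m_gt0 (bf _) (bf _) (bf _)).
by congr expect; apply/funext => s; rewrite tsumZ ?tsum_prod.
Qed.

(** The first-order terms at the two ends of an edge contribute equally, by reversibility;
    summed over the edges at a state they rebuild the Bochner sum in which one of the two
    moves is truncated. *)
Lemma energy_step n f t : in_band f -> 0 <= t -> t * n%:R <= 1 ->
  energy act p c (fun s => f s + t * drift n f s) <=
  energy act p c f - 2 * t * cut_bochner n f +
  t ^+ 2 * (2 * ((M - m) * n%:R) ^+ 2 * (3 / m + 2 * M / m ^+ 2) * tsum (flow act p c)).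
Proof.
move=> bf t0 tn; have bf' := step_in_band bf t0 tn.
set K := (3 / m + _); set H := (M - m) * n%:R.
have s1 := band_energy_finite bf; have s2 := tilt_summable n bf.
have frev := flow_rev c_ge0 c_rev.
have s3 := abs_summable_involution frev s2.
have s12 := abs_summableB s1 (abs_summableZ t (abs_summableD s2 s3)).
have sK := abs_summableZ (t ^+ 2 * (2 * H ^+ 2 * K)) flow_summable.
rewrite /energy.
apply: (@le_trans _ _ (tsum (fun x => flow act p c x * energy_density act f x -
  t * (flow act p c x * tilt n f x + flow act p c x * tilt n f (rev_edge act inv x)) +
  t ^+ 2 * (2 * H ^+ 2 * K) * flow act p c x))); last first.
  rewrite tsumD// tsumZ// tsumB//; last by apply: abs_summableZ; exact: abs_summableD.
  rewrite tsumZ; last exact: abs_summableD.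
  rewrite tsumD// (tsum_involution frev) tilt_bochner//.
  by rewrite le_eqVlt; apply/orP; left; apply/eqP; ring.
apply: ler_tsum; [exact: band_energy_finite|exact: abs_summableD|].
move=> x; have [->|fx] := eqVneq (flow act p c x) 0; first by rewrite !mul0r !mulr0; lra.
have /= [E _] := frev x fx.
move: E; case: x {fx} (flow_ge0 x) => s g; rewrite /rev_edge /= => w0 [E _].
have T := entropy_production_taylor m_gt0 (bf s) (bf (act g s)) (bf' s) (bf' (act g s)).
set w := flow act p c (s, g) in w0 *.
rewrite /tilt /= E /energy_density /grad /logf /=.
have dn y : (f y + t * drift n f y - f y) ^+ 2 <= t ^+ 2 * H ^+ 2.
  rewrite addrAC subrr add0r exprMn ler_wpM2l ?sqr_ge0//.
  have dy := drift_norm n y bf.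
  by rewrite -real_normK ?num_real// lerXn2r ?nnegrE//; exact: le_trans dy.
have K0 : 0 <= K.
  have m0 := m_gt0; have MM : 0 <= M by have := mM s bf; lra.
  by rewrite /K addr_ge0 ?divr_ge0 ?mulr_ge0 ?exprn_ge0// ltW.
have T2 := ler_wpM2r K0 (lerD (dn s) (dn (act g s))).
rewrite -/K in T.
have T3 := ler_wpM2l w0 (le_trans T (lerD (lexx _) T2)).
apply: (le_trans T3); rewrite le_eqVlt; apply/orP; left; apply/eqP; ring.
Qed.

Definition cut_error n : R :=
  tsum (fun x : SGG => two_flow act p c x * (1 - cutoff n x.1 x.2.1)).

(** Each pair of moves is eventually kept, and the second moment dominates. *)
Lemma cut_error_cvg0 : cut_error n @[n --> \oo] --> 0.
Proof.
rewrite -(@tsum0 R (S * (G * G))%type).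
apply: tsum_dominated ((abs_summable_abs _).2 two_flow_summable) _ _ => [n x|x].
  rewrite normrM ler_piMr// ger0_norm ?subr_ge0//.
  by rewrite lerBlDr lerDl.
have near_slow s : \forall n \near \oo, slow n s by exact: nbhs_infty_ger.
apply: filterS2 (near_slow x.1) (near_slow (act x.2.1 x.1)) => n h1 h2.
by rewrite /cutoff h1 h2 subrr mulr0.
Qed.

Lemma cut_bochner_close n f : in_band f ->
  tsum (fun x => two_flow act p c x * bochner_corner act f x) -
    M * (`|ln m| + `|ln M| + M / m) * cut_error n <= cut_bochner n f.
Proof.
move=> bf; set K := M * _.
have cK x : `|bochner_corner act f x| <= K by exact: (corner_bound m_gt0 (bf _) (bf _) (bf _)).
have s1 : abs_summable (fun x => two_flow act p c x * bochner_corner act f x).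
  exact: abs_summable_bounded two_flow_summable cK.
have s2 : abs_summable (fun x : SGG => two_flow act p c x * (1 - cutoff n x.1 x.2.1)).
  apply: (@abs_summable_bounded _ _ _ _ 1 two_flow_summable) => x.
  by rewrite ger0_norm ?subr_ge0// lerBlDr lerDl.
rewrite /cut_error -tsumZ// -tsumB//; last exact: abs_summableZ.
apply: ler_tsum.
- by apply: abs_summableB => //; exact: abs_summableZ.
- apply: (@abs_summable_bounded _ _ _ _ (1 * K) two_flow_summable) => x.
  by rewrite normrM ler_pM.
move=> x; have w0 := two_flow_ge0 act p_gt0 c_ge0 x.
rewrite [X in _ - X]mulrCA -mulrBr ler_wpM2l// lerBlDr -lerBlDl.
have -> : bochner_corner act f x - cutoff n x.1 x.2.1 * bochner_corner act f x =
  (1 - cutoff n x.1 x.2.1) * bochner_corner act f x by ring.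
rewrite mulrC ler_wpM2r ?subr_ge0//.
by apply: le_trans (cK x); exact: ler_norm.
Qed.

End flow_step.

(** * Small energy forces small entropy *)

Lemma entropy_production_lower (R : realType) (a b M : R) :
  0 < a <= M -> 0 < b <= M -> (b - a) ^+ 2 <= M * ((b - a) * (ln b - ln a)).
Proof.
wlog ab : a b / a <= b => [H ha hb|/andP[a0 aM] /andP[b0 bM]].
  have [ab|/ltW ba] := leP a b; first exact: H.
  have := H b a ba hb ha; rewrite -sqrrN opprB => /le_trans; apply.
  by rewrite le_eqVlt; apply/orP; left; apply/eqP; ring.
have h : 0 < b / a by rewrite divr_gt0.
have := ln_ge_1subV h; rewrite invf_div ln_div ?posrE// => l.
have ba0 : 0 <= b - a by rewrite subr_ge0.
have : b * (1 - a / b) <= M * (ln b - ln a).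
  apply: ler_pM => //; first exact: ltW.
  by rewrite subr_ge0 ler_pdivrMr// mul1r.
have -> : b * (1 - a / b) = b - a by field; exact: lt0r_neq0.
by move=> /(ler_wpM2l ba0); rewrite expr2; lra.
Qed.

Section rigidity.
Context {R : realType} {S G : countType} (act : G -> S -> S).
Context (p : S -> R) (c : S -> G -> R).
Context (p_prob : is_prob p) (p_gt0 : forall s, 0 < p s).
Context (c_ge0 : forall s g, 0 <= c s g) (c_irr : irreducible act c).
Context (flow_summable : abs_summable (flow act p c)).
Context (m M : R) (m_gt0 : 0 < m).
Implicit Types f : S -> R.

Local Notation in_band := (@in_band R S m M).
Local Notation energy := (energy act p c).

(** Values at [s] and [t] are forced together by a small energy, uniformly over the
    functions in the band. *)
Let close s t := forall e : R, 0 < e ->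
  exists2 d : R, 0 < d & forall f, in_band f -> energy f <= d -> `|f t - f s| <= e.

(** One edge already contributes at least its weight times (f t - f s)^2 / M. *)
Let close_edge s g : 0 < c s g -> close s (act g s).
Proof.
move=> csg e e0; have [->|gs] := eqVneq (act g s) s.
  by exists 1 => // f _ _; rewrite subrr normr0 ltW.
have w0 : 0 < flow act p c (s, g).
  by rewrite /flow /jump_rate /= gs mulr1 mulr_gt0.
have [M0|M0] := ltP 0 M; last first.
  exists 1 => // f bf _; have /andP[h1 h2] := bf s.
  by have := lt_le_trans m_gt0 (le_trans h1 h2); rewrite ltNge M0.
exists (flow act p c (s, g) * e ^+ 2 / M); first by rewrite divr_gt0// mulr_gt0// exprn_gt0.
move=> f bf; rewrite ler_pdivlMr// => fd.
have f0 t : 0 < f t <= M.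
  by case/andP: (bf t) => h1 ->; rewrite andbT; exact: lt_le_trans h1.
have pf : positive_fct f by move=> t; case/andP: (f0 t).
have lo := entropy_production_lower (f0 s) (f0 (act g s)).
have : flow act p c (s, g) * energy_density act f (s, g) <= energy f.
  apply: (tsum_term_le (F := fun x => flow act p c x * energy_density act f x)).
    move=> x; rewrite mulr_ge0 ?energy_density_ge0//.
    by rewrite /flow mulr_ge0 ?jump_rate_ge0// ltW.
  exact: (band_energy_finite flow_summable m_gt0 bf).
move=> /(ler_wpM2r (ltW M0)) /le_trans /(_ fd); rewrite -mulrA ler_pM2l// => h.
rewrite -(@ler_pXn2r _ 2%N)// ?nnegrE ?(ltW e0)// real_normK ?num_real//.
by apply: le_trans lo _; rewrite mulrC.
Qed.

Let close_trans s t u : close s t -> close t u -> close s u.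
Proof.
move=> st tu e e0; have e2 : 0 < e / 2 by rewrite divr_gt0.
have [d d0 dP] := st _ e2; have [d' d'0 d'P] := tu _ e2.
exists (Num.min d d'); first by rewrite lt_min d0 d'0.
move=> f bf; rewrite le_min => /andP[/(dP f bf) h1 /(d'P f bf) h2].
have -> : f u - f s = (f u - f t) + (f t - f s) by ring.
by apply: le_trans (ler_normD _ _) _; lra.
Qed.

Let close_all s t : close s t.
Proof.
elim: (c_irr s t) => [x y [g [cxg <-]]|x|x y z _ xy _ yz]; first exact: close_edge.
  by move=> e e0; exists 1 => // f _ _; rewrite subrr normr0 ltW.
exact: close_trans xy yz.
Qed.

Let close_seq s (D : seq S) e : 0 < e ->
  exists2 d : R, 0 < d & forall f, in_band f -> energy f <= d ->
    forall t, t \in D -> `|f t - f s| <= e.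
Proof.
move=> e0; elim: D => [|x D [d d0 dP]]; first by exists 1.
have [d' d'0 d'P] := @close_all s x _ e0.
exists (Num.min d d'); first by rewrite lt_min d0 d'0.
move=> f bf; rewrite le_min => /andP[/(dP f bf) h1 /(d'P f bf) h2] t.
by rewrite inE => /orP[/eqP->|/h1].
Qed.

Definition band_Ent f : R := entropy p f - expect p f * ln (expect p f).

Lemma band_expect_summable f : in_band f -> abs_summable (fun s => p s * f s).
Proof.
move=> bf; apply: (@p_mul_summable _ _ _ p_prob _ M) => s.
case/andP: (bf s) => h1 h2; rewrite gtr0_norm//; exact: lt_le_trans h1.
Qed.

(** Comparing the mean with the value at one state bounds the entropy by a variance,
    which is small because a finite set of states carries almost all the mass. *)
Lemma entropy_rigid e : 0 < e ->
  exists2 d : R, 0 < d & forall f, in_band f -> energy f <= d -> band_Ent f <= e.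
Proof.
move=> e0.
have [[s _]|noS] := pselect (exists s : S, True); last first.
  exists 1 => // f _ _; rewrite /band_Ent /entropy /expect.
  have z (F : S -> R) : tsum F = 0.
    rewrite -[RHS](@tsum0 R S); congr tsum; apply/funext => s.
    by exfalso; apply: noS; exists s.
  by rewrite !z mul0r subr0 ltW.
pose K : R := `|M - m| + 1; have K0 : 0 < K by rewrite ltr_wpDl.
(* Half of the variance comes from states close to [s], where |f - a| is at most
   e m / (2 K), and half from the states outside [D], of mass at most e m / (2 K^2). *)
have e1 : 0 < e * m / (2 * K) by rewrite divr_gt0// mulr_gt0.
have e2 : 0 < e * m / (2 * K ^+ 2) by rewrite divr_gt0 ?mulr_gt0 ?exprn_gt0.
have [D [_ _ tD]] := tsum_tail (p_ge0 p_prob) (p_summable p_prob) e2.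
have [d d0 dP] := close_seq s D e1; exists d => // f bf fd.
have {dP fd}cl := dP f bf fd.
set a := f s; set mu := expect p f.
have f0 t : 0 < f t by case/andP: (bf t) => h _; exact: lt_le_trans h.
have a0 : 0 < a by exact: f0.
have dif t : `|f t - a| <= K.
  have /andP[h1 h2] := bf t; have /andP[h3 h4] := bf s.
  have h := ler_norm (M - m).
  by rewrite ler_norml /a /K; apply/andP; split; lra.
have sv : abs_summable (fun t => p t * (f t - a) ^+ 2).
  apply: (@p_mul_summable _ _ _ p_prob _ (K * K)) => t.
  by rewrite expr2 normrM ler_pM.
have sf := band_expect_summable bf; have se := band_entropy_summable p_prob m_gt0 bf.
have sp := p_summable p_prob.
have var : tsum (fun t => p t * (f t - a) ^+ 2) <= e * m.
  pose I t := p t * (t \notin D)%:R.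
  have sI : abs_summable I.
    by apply: (@p_mul_summable _ _ _ p_prob _ 1) => t; case: (t \notin D); rewrite ?normr0 ?normr1.
  apply: (@le_trans _ _ (tsum (fun t => e * m / 2 * p t + K ^+ 2 * I t))).
    apply: ler_tsum => //; first by apply: abs_summableD; exact: abs_summableZ.
    move=> t; rewrite /I; have pt := ltW (p_gt0 t); have dt := dif t.
    have sq : (f t - a) ^+ 2 = `|f t - a| * `|f t - a|.
      by rewrite -expr2 real_normK ?num_real.
    rewrite sq; case: (boolP (t \in D)) => [/cl ct|_] /=.
      rewrite !mulr0 addr0 mulrC ler_wpM2r//.
      apply: (@le_trans _ _ (e * m / (2 * K) * K)); first exact: ler_pM.
      by rewrite le_eqVlt; apply/orP; left; apply/eqP; field; exact: lt0r_neq0.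
    rewrite mulr1 -[leLHS]add0r lerD//.
      by rewrite mulr_ge0// divr_ge0// mulr_ge0 ?ltW.
    by rewrite mulrC ler_wpM2r// expr2 ler_pM.
  rewrite tsumD; try exact: abs_summableZ.
  rewrite !tsumZ// (tsum_p p_prob) mulr1.
  have K2 : 0 <= K ^+ 2 by rewrite exprn_ge0// ltW.
  have := ler_wpM2l K2 tD.
  have -> : K ^+ 2 * (e * m / (2 * K ^+ 2)) = e * m / 2.
    by field; exact: lt0r_neq0.
  by move=> h; rewrite [leRHS](_ : _ = e * m / 2 + e * m / 2) ?lerD2l//; field.
have mu0 : 0 < mu.
  apply: lt_le_trans (mulr_gt0 (p_gt0 s) a0) _.
  by apply: (tsum_term_le (F := fun t => p t * f t)) => // t; rewrite mulr_ge0 ?ltW.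
have tan := entropy_tangent a0 mu0.
have up : entropy p f <= mu * ln a + mu - a + a^-1 * tsum (fun t => p t * (f t - a) ^+ 2).
  have -> : mu * ln a + mu - a + a^-1 * tsum (fun t => p t * (f t - a) ^+ 2) =
      tsum (fun t => (ln a + 1) * (p t * f t) + (- a) * p t +
                     a^-1 * (p t * (f t - a) ^+ 2)).
    rewrite tsumD; [|by apply: abs_summableD; exact: abs_summableZ|exact: abs_summableZ].
    rewrite tsumD; try exact: abs_summableZ.
    by rewrite !tsumZ// (tsum_p p_prob) /mu /expect; ring.
  apply: ler_tsum => //.
    by apply: abs_summableD; [apply: abs_summableD|]; exact: abs_summableZ.
  move=> t; have h : 0 < f t / a by rewrite divr_gt0.
  have := ln_le_sub1 h; rewrite ln_div ?posrE// => l.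
  have := ler_wpM2l (ltW (p_gt0 t)) (ler_wpM2l (ltW (f0 t)) l).
  have -> : p t * (f t * (f t / a - 1)) =
      p t * (f t - a) + a^-1 * (p t * (f t - a) ^+ 2) by field; exact: lt0r_neq0.
  by lra.
have : a^-1 * tsum (fun t => p t * (f t - a) ^+ 2) <= e.
  rewrite ler_pdivrMl// mulrC; apply: le_trans var _; rewrite ler_wpM2l ?(ltW e0)//.
  by case/andP: (bf s).
by rewrite /band_Ent -/mu; lra.
Qed.

End rigidity.

(** * The logarithmic Sobolev inequality in a band *)

Section bounded_mlsi.
Context {R : realType} {S G : countType} (act : G -> S -> S) (inv : G -> G).
Context (p : S -> R) (c : S -> G -> R) (kappa : R) (kappa_gt0 : 0 < kappa).
Context (p_prob : is_prob p) (p_gt0 : forall s, 0 < p s).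
Context (c_ge0 : forall s g, 0 <= c s g) (c_rev : reversible act inv p c).
Context (c_irr : irreducible act c).
Context (jump_summable : forall s, abs_summable (jump_rate act c s)).
Context (flow_summable : abs_summable (flow act p c)).
Context (two_flow_summable : abs_summable (two_flow act p c)).
Context (m M : R) (m_gt0 : 0 < m).
Context (bochner : forall f, in_band m M f ->
  kappa / 2 * energy act p c f <= tsum (fun x => two_flow act p c x * bochner_corner act f x)).

Local Notation energy := (energy act p c).
Local Notation in_band := (@in_band R S m M).
Implicit Types f : S -> R.

Let objective l f : R := l * entropy p f - 2^-1 * energy f.

(** To first order in [t], the step of length [t] changes the objective by
    t (B(f) - l E(f)), with E the Dirichlet form and B(f) >= kappa E(f). *)
Let objective_step l d : 0 < l -> l < kappa -> 0 < d ->
  exists2 eta : R, 0 < eta & forall f, in_band f -> d < energy f ->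
    exists f', [/\ in_band f', expect p f' = expect p f &
      objective l f + eta <= objective l f'].
Proof.
move=> l0 lk d0.
pose gap := (kappa - l) * d; have gap0 : 0 < gap by rewrite mulr_gt0// subr_gt0.
pose K := M * (`|ln m| + `|ln M| + M / m).
have [n nP] : exists n, K * cut_error act p c n <= gap / 8.
  have cv : (K * cut_error act p c n) @[n --> \oo] --> K * 0.
    by apply: cvgM; [exact: cvg_cst|exact: cut_error_cvg0].
  rewrite mulr0 in cv; have g8 : 0 < gap / 8 by rewrite divr_gt0.
  have /cvgrPdist_le/(_ _ g8)/filter_ex[n hn] := cv; exists n.
  by apply: le_trans (ler_norm _) _; move: hn; rewrite sub0r normrN.
pose Q := 2 * ((M - m) * n%:R) ^+ 2 * (3 / m + 2 * M / m ^+ 2) * tsum (flow act p c).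
(* The step is short enough both to stay in the band, t n <= 1, and to make the
   second-order error t Q at most a quarter of the gap. *)
pose t := (n%:R + 1 + `|Q| * 4 / gap)^-1.
have Qg : 0 <= `|Q| * 4 / gap by apply: divr_ge0; [exact: mulr_ge0|exact: ltW].
have n0 : 0 <= n%:R :> R by exact: ler0n.
have tden : 0 < n%:R + 1 + `|Q| * 4 / gap by lra.
have t0 : 0 < t by rewrite invr_gt0.
have tn : t * n%:R <= 1 by rewrite mulrC ler_pdivrMr// mul1r; lra.
have tQ : t * `|Q| <= gap / 4.
  rewrite mulrC ler_pdivrMr//.
  have -> : gap / 4 * (n%:R + 1 + `|Q| * 4 / gap) = gap / 4 * (n%:R + 1) + `|Q|.
    by field; exact: lt0r_neq0.
  by rewrite lerDr; apply: mulr_ge0; [rewrite divr_ge0// ltW|exact: addr_ge0].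
exists (t * (gap / 4)); first by rewrite mulr_gt0// divr_gt0.
move=> f bf fd; exists (fun s => f s + t * drift act c n f s); split.
- exact: (step_in_band c_ge0 jump_summable bf (ltW t0) tn).
- have sd : abs_summable (fun s => p s * drift act c n f s).
    apply: (p_mul_summable p_prob) => s; exact: (drift_norm c_ge0 jump_summable _ _ bf).
  have sf := band_expect_summable p_prob m_gt0 bf.
  rewrite /expect -[RHS]addr0.
  rewrite -(mulr0 t) -(expect_drift0 p_gt0 c_ge0 c_rev jump_summable flow_summable n bf).
  rewrite /expect -tsumZ// -tsumD//; last exact: abs_summableZ.
  by congr tsum; apply/funext => s; ring.
have E1 := entropy_step p_prob p_gt0 c_ge0 c_rev jump_summable flow_summable m_gt0 bf (ltW t0) tn.
have E2 := energy_step p_prob p_gt0 c_ge0 c_rev jump_summable flow_summable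
  two_flow_summable m_gt0 bf (ltW t0) tn.
rewrite -/Q in E2.
have E3 := cut_bochner_close p_gt0 c_ge0 two_flow_summable m_gt0 n bf.
have E4 := bochner bf.
rewrite /objective; set f' := (fun s => _) in E1 E2 *.
have L1 := ler_wpM2l (ltW l0) E1.
have Qn : t ^+ 2 * Q <= t * (gap / 4).
  rewrite expr2 -mulrA ler_wpM2l ?(ltW t0)//; apply: le_trans tQ.
  by rewrite ler_wpM2l ?(ltW t0)// ler_norm.
rewrite -/K in E3.
have L3 := ler_wpM2l (ltW t0) (le_trans (lerB E4 nP) E3).
have L4 : gap <= (kappa - l) * energy f by rewrite /gap ler_wpM2l ?(ltW fd)// subr_ge0 ltW.
have L5 := ler_wpM2l (ltW t0) L4.
by lra.
Qed.

Let objective_bounded l f : 0 < l -> in_band f ->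
  objective l f <= l * (M * (`|ln m| + `|ln M|)).
Proof.
move=> l0 bf.
have e0 := band_energy_ge0 p_prob c_ge0 flow_summable m_gt0 bf.
suff : entropy p f <= M * (`|ln m| + `|ln M|).
  by move=> /(ler_wpM2l (ltW l0)); rewrite /objective; lra.
have sp := p_summable p_prob.
rewrite -[leRHS]mulr1 -(tsum_p p_prob) -tsumZ//; apply: ler_tsum.
- exact: (band_entropy_summable p_prob m_gt0 bf).
- exact: (abs_summableZ _ sp).
move=> s; rewrite mulrC ler_wpM2r//; first exact: ltW.
apply: le_trans (ler_norm _) _; rewrite normrM ler_pM// ?(ln_band_norm m_gt0 s bf)//.
by rewrite (gtr0_norm (band_gt0 m_gt0 bf s)); case/andP: (bf s).
Qed.

(** Repeated steps cannot increase a bounded objective for ever, so they reach a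
    function of arbitrarily small energy. *)
Let objective_flat l d f : 0 < l -> l < kappa -> 0 < d -> in_band f ->
  exists f', [/\ in_band f', expect p f' = expect p f,
    objective l f <= objective l f' & energy f' <= d].
Proof.
move=> l0 lk d0 bf; apply: contrapT => none.
have [eta eta0 step] := objective_step l0 lk d0.
have climb k : exists f', [/\ in_band f', expect p f' = expect p f &
    objective l f + eta *+ k <= objective l f'].
  elim: k => [|k [f1 [b1 p1 j1]]]; first by exists f; split=> //; rewrite mulr0n addr0.
  have big : d < energy f1.
    rewrite ltNge; apply/negP => small; apply: none; exists f1; split=> //.
    by apply: le_trans j1; rewrite lerDl mulrn_wge0// ltW.
  have [f2 [b2 p2 j2]] := step f1 b1 big; exists f2; split=> //; first by rewrite p2.
  by apply: le_trans j2; rewrite mulrSr addrA lerD2r.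
pose top := l * (M * (`|ln m| + `|ln M|)).
have [k hk] : exists k : nat, top - objective l f < eta *+ k.
  have := archi_boundP (normr_ge0 ((top - objective l f) / eta)).
  set k := Num.bound _ => hk; exists k.
  rewrite -mulr_natl -ltr_pdivrMr//; apply: le_lt_trans hk; exact: ler_norm.
have [f' [b' _ j']] := climb k.
by have := objective_bounded l0 b'; rewrite -/top; lra.
Qed.

Lemma band_mlsi f : in_band f -> kappa * band_Ent p f <= 2^-1 * energy f.
Proof.
move=> bf; have e0 := band_energy_ge0 p_prob c_ge0 flow_summable m_gt0 bf.
have below l : 0 < l -> l < kappa -> l * band_Ent p f <= 2^-1 * energy f.
  move=> l0 lk; apply/ler_addgt0Pr => e e_gt0.
  have el : 0 < e / l by rewrite divr_gt0.
  have [d d0 dP] := entropy_rigid p_prob p_gt0 c_ge0 c_irr flow_summable M m_gt0 el.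
  have [f' [b' p' j' /(dP f' b')]] := objective_flat l0 lk d0 bf.
  rewrite ler_pdivlMr// mulrC; move: j'; rewrite /objective /band_Ent p'.
  have := band_energy_ge0 p_prob c_ge0 flow_summable m_gt0 b'.
  by lra.
rewrite leNgt; apply/negP => gt.
have E0 : 0 < band_Ent p f.
  by rewrite -(pmulr_rgt0 _ kappa_gt0); apply: le_lt_trans gt; rewrite mulr_ge0.
set E := band_Ent p f in gt E0 below; set A := 2^-1 * energy f in gt below.
have A0 : 0 <= A by rewrite mulr_ge0.
have q : A / E < kappa by rewrite ltr_pdivrMr.
have q0 : 0 <= A / E by rewrite divr_ge0// ltW.
(* A constant strictly between A/E and kappa contradicts the bound below kappa. *)
have := below ((A / E + kappa) / 2).
have k0 := kappa_gt0.
have h1 : 0 < (A / E + kappa) / 2 by lra.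
have h2 : (A / E + kappa) / 2 < kappa by lra.
move=> /(_ h1 h2); have -> : (A / E + kappa) / 2 * E = (A + kappa * E) / 2.
  by field; exact: lt0r_neq0.
by lra.
Qed.

End bounded_mlsi.

(** * Removing the truncation *)

Section truncated_entropy.
Context {R : realType} {S : countType} (p : S -> R).
Context (p_prob : is_prob p) (p_gt0 : forall s, 0 < p s).
Context (f : S -> R) (f_gt0 : positive_fct f).

Let mean (N : nat) : R := expect p (truncate f N).

Let in_bandN N : in_band N.+1%:R^-1 N.+1%:R (truncate f N).
Proof. by move=> s; apply: clamp_itv; exact: trunc_lohi. Qed.

Let trunc_gt0 N : positive_fct (truncate f N).
Proof. by move=> s; apply: clamp_gt0; [exact: trunc_lo|exact: trunc_lohi]. Qed.

Let meanS N := band_expect_summable p_prob (@trunc_lo R N) (in_bandN N).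
Let entS N := band_entropy_summable p_prob (@trunc_lo R N) (in_bandN N).

Lemma truncate_le N s : truncate f N s <= f s + 1.
Proof.
rewrite /truncate /clamp ge_max; apply/andP; split.
  have h : N.+1%:R^-1 <= 1 :> R by rewrite invf_le1// ler1n.
  by apply: (le_trans h); rewrite lerDr ltW.
by rewrite ge_min lerDl ler01.
Qed.

Lemma state_inhabited : exists s : S, True.
Proof.
apply: contrapT => noS; have := tsum_p p_prob.
rewrite (_ : p = fun=> 0) ?tsum0; first by move/eqP; rewrite eq_sym oner_eq0.
by apply/funext => s; exfalso; apply: noS; exists s.
Qed.

Let mean_gt0 N : 0 < mean N.
Proof.
have [s _] := state_inhabited.
apply: lt_le_trans (mulr_gt0 (p_gt0 s) (trunc_gt0 N s)) _.
apply: (tsum_term_le (F := fun t => p t * truncate f N t)) => // t.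
by rewrite mulr_ge0 ?(ltW (p_gt0 t)) ?(ltW (trunc_gt0 N t)).
Qed.

(** Were the mean large, the normalised function would nearly vanish at any given
    state; by Gibbs' inequality against the density that is halved at this state,
    this costs an entropy proportional to the mean. *)
Lemma mean_truncate_bounded e : (forall N, band_Ent p (truncate f N) <= e) ->
  exists C : R, forall N, mean N <= C.
Proof.
move=> Ee; have [s0 _] := state_inhabited.
have p0 := p_gt0 s0.
have p1 : p s0 <= 1.
  by rewrite -(tsum_p p_prob); apply: tsum_term_le; [exact: p_ge0|exact: p_summable].
pose q := 1 - p s0 / 2.
have q0 : 0 < q by rewrite /q; lra.
have lq : 0 < - ln q by rewrite oppr_gt0 ln_lt0//; apply/andP; split; rewrite /q; lra.
exists ((e + (f s0 + 1) * ln 2) / - ln q) => N; rewrite ler_pdivlMr//.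
set mu := mean N; have mu0 : 0 < mu by exact: mean_gt0.
set g := truncate f N; have g0 : positive_fct g by exact: trunc_gt0.
have sp := p_summable p_prob; have sg := meanS N; have se := entS N.
rewrite -/g in sg se.
(* The comparison density, with the same mean as [g]: q is the mass of the halved weight. *)
pose z s := mu / q * (if s == s0 then 2^-1 else 1).
have z0 s : 0 < z s by rewrite /z mulr_gt0 ?divr_gt0//; case: ifP => _; rewrite ?invr_gt0.
have lnz s : ln (z s) = ln mu - ln q - (s == s0)%:R * ln 2.
  rewrite /z lnM ?posrE ?divr_gt0//; last by case: ifP => _; rewrite ?invr_gt0.
  rewrite ln_div ?posrE//; case: (s == s0); last by rewrite ln1 mul0r subr0 addr0.
  by rewrite lnV ?posrE// mul1r.
have single (F : S -> R) := @tsum_single R S (fun s => (s == s0)%:R * F s) s0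
  (fun t (ts : t != s0) => etrans (congr1 (fun b : bool => b%:R * F t) (negPf ts)) (mul0r _)).
have low : tsum (fun s => (ln mu - ln q + 1) * (p s * g s) - mu / q * p s
    + (s == s0)%:R * (mu / (2 * q) * p s - p s * g s * ln 2)) <= entropy p g.
  apply: ler_tsum => //.
    apply: abs_summableD; last exact: (single _).1.
    by apply: abs_summableB; exact: abs_summableZ.
  move=> s; have := ler_wpM2l (ltW (p_gt0 s)) (entropy_tangent (z0 s) (g0 s)).
  rewrite lnz /z; case: eqP => [_|_] /= h; apply: le_trans h;
    by rewrite le_eqVlt; apply/orP; left; apply/eqP; field; exact: lt0r_neq0.
move: low; rewrite tsumD; [|by apply: abs_summableB; exact: abs_summableZ|exact: (single _).1].
rewrite tsumB; try exact: abs_summableZ.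
rewrite !tsumZ// (tsum_p p_prob) mulr1 (single _).2 eqxx mul1r.
rewrite -[tsum _]/(mean N) -/mu => low.
have := Ee N; rewrite /band_Ent -/g -[expect p g]/mu => up.
have gs : g s0 <= f s0 + 1 by exact: truncate_le.
have l2 : 0 < ln 2 :> R by rewrite ln_gt0// ltr1n.
have b1 : p s0 * g s0 * ln 2 <= (f s0 + 1) * ln 2.
  rewrite ler_wpM2r ?(ltW l2)//; apply: le_trans gs.
  by rewrite ler_piMl// ltW.
have E : mu / q - mu / (2 * q) * p s0 = mu.
  have -> : mu / q - mu / (2 * q) * p s0 = mu / q * (1 - p s0 / 2).
    by field; exact: lt0r_neq0.
  by rewrite -/q divfK// lt0r_neq0.
by lra.
Qed.

Let xlnx_ge x : 0 < x -> x - 1 <= x * ln x :> R.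
Proof. by move=> x0; have := entropy_tangent ltr01 x0; rewrite ln1; lra. Qed.

(** Since ln x <= x - 1, the bound on the mean controls the term subtracted in the entropy. *)
Let entropy_truncate_bounded e : (forall N, band_Ent p (truncate f N) <= e) ->
  exists C : R, forall N, entropy p (truncate f N) <= C.
Proof.
move=> Ee; have [C CP] := mean_truncate_bounded Ee; exists (e + C * C) => N.
have := Ee N; rewrite /band_Ent -/(mean N).
have m0 := mean_gt0 N; have mC := CP N; have C0 : 0 < C by exact: lt_le_trans mC.
have := ler_wpM2l (ltW m0) (ln_le_sub1 m0).
have : mean N * mean N <= C * C by rewrite ler_pM// ltW.
by lra.
Qed.

(** On a finite set of states a late truncation agrees with [f], so that the bound on the
    truncated entropies bounds all partial sums; adding 1 makes the terms non-negative. *)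
Lemma entropy_summable e : (forall N, band_Ent p (truncate f N) <= e) ->
  abs_summable (fun s => p s * (f s * ln (f s) + 1)).
Proof.
move=> Ee; have [C CP] := entropy_truncate_bounded Ee.
apply: (@abs_summable_bound _ _ _ (C + 1)) => D uD.
have : \forall N \near \oo, forall s, s \in D -> truncate f N s = f s.
  elim: D {uD} => [|x D IH]; first by near=> N.
  apply: filterS2 IH (truncate_near f_gt0 x) => N h hx s.
  by rewrite inE => /orP[/eqP->|/h].
move=> /filter_ex[N ND].
have ge0 g s : positive_fct g -> 0 <= p s * (g s * ln (g s) + 1).
  by move=> g0; rewrite mulr_ge0 ?(ltW (p_gt0 s))//; have := xlnx_ge (g0 s); have := g0 s; lra.
have sp := p_summable p_prob; have sN := entS N.
have E s : p s * (truncate f N s * ln (truncate f N s) + 1) =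
    p s * (truncate f N s * ln (truncate f N s)) + p s by ring.
apply: (@le_trans _ _ (tsum (fun s => p s * (truncate f N s * ln (truncate f N s) + 1)))).
  rewrite (eq_big_seq (fun s => p s * (truncate f N s * ln (truncate f N s) + 1))).
    apply: tsum_finite_le => // [s|]; first exact: ge0.
    by rewrite (funext E); exact: abs_summableD.
  by move=> s sD; rewrite ger0_norm ?ge0// ND.
by rewrite (funext E) tsumD// (tsum_p p_prob) lerD2r; exact: CP.
Unshelve. all: by end_near.
Qed.

(** Below 1 the function x ln x is not monotone, but it is bounded there by 1 in
    absolute value. *)
Let xlnx_clamp N s : `|truncate f N s * ln (truncate f N s)| <= `|f s * ln (f s)| + 1.
Proof.
rewrite /truncate; set x := f s; have x0 : 0 < x by exact: f_gt0.
set m := N.+1%:R^-1; set M := N.+1%:R.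
have m0 : 0 < m :> R by exact: trunc_lo.
have M1 : 1 <= M :> R by rewrite ler1n.
have m1 : m <= 1 :> R by rewrite invf_le1// ltr0Sn.
have n0 := normr_ge0 (x * ln x).
have [xm|mx] := leP x m.
  rewrite /clamp min_l ?max_l//; last by apply: le_trans xm _; exact: trunc_lohi.
  have h := xlnx_ge m0; have h' : m * ln m <= 0 by rewrite mulr_ge0_le0 ?(ltW m0)// ln_le0.
  by rewrite ler0_norm//; lra.
have [xM|Mx] := leP x M; first by rewrite clamp_id ?(ltW mx)// lerDl.
rewrite /clamp min_r ?max_r ?(ltW Mx)//; last exact: trunc_lohi.
have lM : 0 <= ln M by exact: ln_ge0.
have lMx : ln M <= ln x by rewrite ler_ln ?posrE ?(ltW Mx)//; exact: lt_le_trans M1.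
have MM : 0 <= M by lra.
rewrite ger0_norm ?mulr_ge0//; apply: (@le_trans _ _ (x * ln x)); first by rewrite ler_pM// ltW.
by have := ler_norm (x * ln x); lra.
Qed.

(** Truncation does not lose entropy in the limit; finiteness of the limit is part of
    the conclusion. *)
Lemma Ent_le_of_truncate e : (forall N, band_Ent p (truncate f N) <= e) ->
  (Ent p f <= e%:E)%E.
Proof.
move=> Ee; have sE1 := entropy_summable Ee; have sp := p_summable p_prob.
have sE : abs_summable (fun s => p s * (f s * ln (f s))).
  apply: abs_summable_eq (abs_summableB sE1 sp) => s; ring.
have sf : abs_summable (fun s => p s * f s).
  apply: abs_summable_le sE1 => s; rewrite !ger0_norm.
  - by rewrite ler_wpM2l ?(ltW (p_gt0 s))//; have := xlnx_ge (f_gt0 s); lra.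
  - rewrite mulr_ge0 ?(ltW (p_gt0 s))//.
    by have := xlnx_ge (f_gt0 s); have := f_gt0 s; lra.
  - by rewrite mulr_ge0 ?(ltW (p_gt0 s)) ?(ltW (f_gt0 s)).
rewrite /Ent asboolT// lee_fin.
have cE : entropy p (truncate f N) @[N --> \oo] --> entropy p f.
  apply: (@tsum_dominated _ _ _ _ (fun s => p s * (`|f s * ln (f s)| + 1))) => [|N s|s].
  - apply: abs_summable_eq (abs_summableD ((abs_summable_abs _).2 sE) sp) => s.
    by rewrite [`|p s * _|]normrM (gtr0_norm (p_gt0 s)); ring.
  - by rewrite normrM (gtr0_norm (p_gt0 s)) ler_wpM2l ?(ltW (p_gt0 s))//; exact: xlnx_clamp.
  - by apply: filterS (truncate_near f_gt0 s) => N ->.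
have cm : mean N @[N --> \oo] --> expect p f.
  apply: (@tsum_dominated _ _ _ _ (fun s => p s * f s + p s)) => [|N s|s].
  - exact: abs_summableD.
  - rewrite normrM (gtr0_norm (p_gt0 s)) (gtr0_norm (trunc_gt0 N s)).
    by have := ler_wpM2l (ltW (p_gt0 s)) (truncate_le N s); lra.
  - by apply: filterS (truncate_near f_gt0 s) => N ->.
have mf0 : 0 < expect p f.
  have [s _] := state_inhabited; apply: lt_le_trans (mulr_gt0 (p_gt0 s) (f_gt0 s)) _.
  by apply: (tsum_term_le (F := fun t => p t * f t)) => // t; rewrite mulr_ge0 ?(ltW (p_gt0 t)) ?(ltW (f_gt0 t)).
have cl : ln (mean N) @[N --> \oo] --> ln (expect p f).
  by apply: continuous_cvg => //; exact: continuous_ln.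
have cB : band_Ent p (truncate f N) @[N --> \oo] --> band_Ent p f.
  by apply: cvgB => //; exact: cvgM.
have ce : (fun _ : nat => e) @ \oo --> e by exact: cvg_cst.
by apply: (ler_cvg_to cB ce); near=> N.
Unshelve. all: by end_near.
Qed.

End truncated_entropy.

(** * Conclusion for positive functions *)

Theorem proposition2p5 (R : realType) (S G : countType)
  (act : G -> S -> S) (act_inj : injective act) (inv : G -> G)
  (p : S -> R) (c : S -> G -> R) (r : S -> G -> G -> R) (kappa : R)
  (p_prob : is_prob p)
  (c_ge0 : forall s g, 0 <= c s g)
  (c_rev : reversible act inv p c)
  (c_irr : irreducible act c)
  (r_ge0 : forall s g d, 0 <= r s g d)
  (r_inv : forall s g d, 0 < r s g d -> act (inv g) (act g s) = s)
  (r_P1 : P1 r) (r_P2 : P2 act inv p r) (r_P3 : P3 act r)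
  (kappa_gt0 : 0 < kappa)
  (Gamma_defined : forall f : S -> R, bounded_pos f ->
    expect2_defined p (bochner_term act (Gamma c r) f))
  (Gamma_ge : forall f : S -> R, positive_fct f ->
    expect2_defined p (bochner_term act (Gamma c r) f) ->
    abs_summable (fun x : S * G => p x.1 * energy_term act c f (logf f) x.1 x.2) ->
    kappa / 2 * expect p (fun s => tsum (energy_term act c f (logf f) s)) <=
    expect2 p (bochner_term act (Gamma c r) f)) :
  [/\ (forall f : S -> R, positive_fct f ->
        dirichlet_defined act p c f (logf f) ->
        expect2_defined p (bochner_term act (rate2 c) f) ->
        kappa * dirichlet act p c f (logf f) <=
        expect p (fun s => generator act c f s * generator act c (logf f) s) +
        expect p (fun s => generator act c f s ^+ 2 / f s)),
      (forall f : S -> R, positive_fct f ->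
        dirichlet_defined act p c f (logf f) ->
        (kappa%:E * Ent p f <= (dirichlet act p c f (logf f))%:E)%E)
    & (forall f : S -> R, positive_fct f ->
        (kappa%:E * Ent p f <=
         2^-1%:E * \esum_(x in [set: S * G])
                     (p x.1 * energy_term act c f (logf f) x.1 x.2)%:E)%E)].
Proof.
have p_gt0 := p_gt0 p_prob c_ge0 c_rev c_irr.
have sC := two_flow_corner_summable r_P2 Gamma_defined.
have jumpS := jump_summable p_gt0 c_ge0 sC.
have flowS := flow_summable p_prob p_gt0 c_ge0 c_rev sC.
have twoS := two_flow_summable p_gt0 c_ge0 c_rev sC.
have mlsi f : positive_fct f -> energy_finite act p c f ->
    (kappa%:E * Ent p f <= (2^-1 * energy act p c f)%:E)%E.
  move=> f0 sE.
  suff h : (Ent p f <= (kappa^-1 * (2^-1 * energy act p c f))%:E)%E.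
    apply: le_trans (lee_wpmul2l _ h) _; first by rewrite lee_fin ltW.
    by rewrite -EFinM mulVKf// gt_eqF.
  apply: Ent_le_of_truncate => // N; rewrite ler_pdivlMl//.
  have bt : in_band N.+1%:R^-1 N.+1%:R (truncate f N).
    by move=> s; apply: clamp_itv; exact: trunc_lohi.
  have bb h : in_band N.+1%:R^-1 N.+1%:R h -> kappa / 2 * energy act p c h <=
      tsum (fun x => two_flow act p c x * bochner_corner act h x).
    move=> bh; apply: (bochner_bounded p_gt0 r_ge0 r_inv r_P1 r_P2 r_P3 Gamma_defined Gamma_ge).
      by exists N.+1%:R^-1, N.+1%:R; split; first exact: trunc_lo.
    exact: (band_energy_finite flowS (@trunc_lo R N) bh).
  apply: le_trans (band_mlsi kappa_gt0 p_prob p_gt0 c_ge0 c_rev c_irr jumpS flowS twoS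
    (@trunc_lo R N) bb bt) _.
  by rewrite ler_wpM2l//; exact: energy_truncate_le.
split.
- move=> f f0 def sB; have [sE ->] := dirichlet_energy p_prob c_ge0 c_rev c_irr f0 def.
  have sB' : abs_summable (fun x => two_flow act p c x * bochner_corner act f x).
    by move: sB; apply: abs_summable_eq => x; rewrite bochner_termE rate2_corner.
  rewrite (bochner_expand p_gt0 f0 sB') mulrA.
  exact: (bochner_inequality p_gt0 r_ge0 r_inv r_P1 r_P2 r_P3 Gamma_defined Gamma_ge f0 sE sB').
- move=> f f0 def; have [sE ->] := dirichlet_energy p_prob c_ge0 c_rev c_irr f0 def.
  exact: mlsi.
move=> f f0; rewrite (eq_esum (b := fun x => (flow act p c x * energy_density act f x)%:E)); last first.
  by move=> x _; rewrite energy_flow.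
have e0 x : 0 <= flow act p c x * energy_density act f x.
  by rewrite mulr_ge0 ?energy_density_ge0//; exact: flow_ge0.
have [sE|nE] := pselect (energy_finite act p c f).
  by rewrite -tsum_EFin// -EFinM; exact: mlsi.
rewrite (_ : esum _ _ = +oo%E); first by rewrite gt0_muley ?leey// lte_fin invr_gt0.
apply/eqP; rewrite -leye_eq leNgt; apply/negP => lt; apply: nE.
rewrite /energy_finite abs_summableE (eq_esum (b := fun x => (flow act p c x * energy_density act f x)%:E))//.
by move=> x _; rewrite ger0_norm.
Qed.
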